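(* Let $A$ and $A'$ be two finite symmetric sets of free generators of a finitely generated non-abelian free group $\Gamma$, and denote by $\mathbb F_A$ and $\mathbb F_{A'}$ the group $\Gamma$ as generated by $A$ and $A'$ respectively. Then for every $\pi\in\mathbf{Mult}(\mathbb F_{A'})$ there exists a matrix system with inner products indexed on $A$ that realizes $\pi$ as an element of $\mathbf{Mult}(\mathbb F_A)$; that is, $\pi\in\mathbf{Mult}(\mathbb F_A)$. In particular the class $\mathbf{Mult}(\Gamma)$ is $\operatorname{Aut}(\Gamma)$-invariant: if $\pi\in\mathbf{Mult}(\Gamma)$ and $\varphi\in\operatorname{Aut}(\Gamma)$, then $\pi\circ\varphi\in\mathbf{Mult}(\Gamma)$.
   Context: $A$ symmetric means: $A=S\sqcup S^{-1}$ with $S$ a free basis of $\Gamma$. All of the following depends on $A$ (and is defined in the same way for $A'$). $a,b$ denote elements of $A$; $|x|$ is the length of the reduced word of $x\in\Gamma$ in the alphabet $A$; $E(a)$ is the set of $x$ whose reduced word ends with $a$. A matrix system $(V_a,H_{ba})$ consists of a finite dimensional complex vector space $V_a$ for each $a\in A$ and a linear map $H_{ba}:V_a\to V_b$ for each $a,b\in A$, with $H_{ba}=0$ whenever $ab=e$. A matrix system with inner products $(V_a,H_{ba},B_a)$ is a matrix system with a positive definite (Hermitian) sesquilinear form $B_a$ on each $V_a$ such that $B_a(v_a,v_a)=\sum_{b\in A}B_b(H_{ba}v_a,H_{ba}v_a)$ for all $a\in A$, $v_a\in V_a$. A multiplicative function is a function $f:\Gamma\to\coprod_{a\in A}V_a$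 for which there is $N=N(f)\ge 0$ such that for every $x$ with $|x|\ge N$: $f(x)\in V_a$ if $x\in E(a)$, and $f(xb)=H_{ba}f(x)$ if $x\in E(a)$ and $|xb|=|x|+1$. Two multiplicative functions are identified if they agree at all but finitely many points; $\mathcal H^\infty=\mathcal H^\infty(V_a,H_{ba})$ is the vector space of equivalence classes, with pointwise operations. For $f_1,f_2\in\mathcal H^\infty$ put $\langle f_1,f_2\rangle=\sum_{|x|=N}\sum_{a:\,|xa|=|x|+1}B_a(f_1(xa),f_2(xa))$ for $N$ large (independent of $N$). $\mathcal H(V_a,H_{ba},B_a)$ is the Hilbert space completion of $\mathcal H^\infty$, carrying the unitary representation $\pi$ of $\Gamma$ extending $(\pi(x)f)(y)=f(x^{-1}y)$. A unitary representation $(\rho,H)$ of $\Gamma$ belongs to $\mathbf{Mult}(\mathbb F_A)$ if there exist a matrix system with inner products $(V_a,H_{ba},B_a)$ indexed on $A$, a dense subspace $M\subseteq H$ and a unitary operator $U:H\to\mathcal H(V_a,H_{ba},B_a)$ such that $U$ restricts to an isomorphism of $M$ onto $\mathcal H^\infty(V_a,H_{ba})$ and $U(\rho(x)m)=\pi(x)(Um)$ for all $m\in M$, $x\in\Gamma$. A representation belongs to $\mathbf{Mult}(\Gamma)$ if it belongs to $\mathbf{Mult}(\mathbb F_A)$ for some finite symmetric set $A$ of free generators of $\Gamma$. *)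

(* Defs.v *)
From HB Require Import structures.
From mathcomp Require Import all_boot all_order all_algebra finmap.
From mathcomp Require Import generic_quotient sesquilinear complex.
From mathcomp Require Import all_classical all_reals all_analysis.
Set Implicit Arguments.
Unset Strict Implicit.
Unset Printing Implicit Defensive.
Import Order.TTheory GRing.Theory Num.Theory numFieldNormedType.Exports.

Local Open Scope classical_set_scope.
Local Open Scope ring_scope.
Local Open Scope quotient_scope.

Section FreeGenerators.
Variable G : groupType.
Local Open Scope group_scope.

Definition nonabelian := exists x y : G, x * y <> y * x.

(* The pair (s, true) stands for the letter s and (s, false) for the letter
   s^-1; the first condition on w says that it is freely reduced. *)
Definition free_basis (S : {fset G}) := forall x : G,
  exists! w : seq (S * bool),
    sorted (fun l m => ~~ ((l.1 == m.1) && (l.2 != m.2))) w /\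
    \prod_(l <- w) (if l.2 then val l.1 else (val l.1)^-1) = x.

Definition symmetric_free (A : {fset G}) := exists S : {fset G},
  let SV := [fset s^-1 | s in S]%fset in
  [/\ A = (S `|` SV)%fset, [disjoint S & SV]%fset & free_basis S].

Variable A : {fset G}.
Implicit Types (w : seq A) (a b : A) (x : G).

Definition reduced w := sorted (fun a b => val a * val b != 1) w.

Definition wprod w : G := \prod_(a <- w) val a.

Definition redword x : seq A :=
  xget [::] [set w | reduced w /\ wprod w = x].

Definition wlen x := size (redword x).

(* x belongs to E(a) *)
Definition ends_with a x := exists w, redword x = rcons w a.

Hypothesis hA : symmetric_free A.

Lemma reduced_word_uniq x : exists! w, reduced w /\ wprod w = x.
Proof.
case: hA => S [AE dis fb].
pose ltr (l : S * bool) : G := if l.2 then val l.1 else (val l.1)^-1.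
have inA z : (z \in A) = (z \in S) || (z \in [fset s^-1 | s in S]%fset).
  by rewrite AE inE.
have ltrA l : ltr l \in A.
  rewrite inA /ltr; case: l => s [] /=; first by rewrite (valP s).
  by apply/orP; right; apply: in_imfset; exact: valP.
pose f l : A := [` ltrA l]%fset.
have disP (s t : S) : val s != (val t)^-1.
  apply/eqP => e; move/fdisjointP: dis => /(_ _ (valP s)) /negP; apply.
  by rewrite e; apply: in_imfset; exact: valP.
have ltrI : injective ltr.
  move=> [s []] [t []]; rewrite /ltr /= => e.
  - by congr pair; exact: val_inj.
  - by move/eqP: (disP s t).
  - by move/eqP: (disP t s) => /(_ (esym e)).
  - by congr pair; apply: val_inj; exact: invg_inj.
have fI : injective f by move=> l m /(congr1 val) /ltrI.
have ltrV l : (ltr l)^-1 = ltr (l.1, ~~ l.2).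
  by case: l => s []; rewrite /ltr //= invgK.
have fS a : exists l, f l = a.
  have := valP a; rewrite inA => /orP[aS|/imfsetP[/= s sS e]].
    by exists ([` aS]%fset, true); apply: val_inj.
  by exists ([` sS]%fset, false); apply: val_inj; rewrite /= /ltr /= e.
have [g gK] := choice fS.
have fE l m : (val (f l) * val (f m) != 1) = ~~ ((l.1 == m.1) && (l.2 != m.2)).
  congr (~~ _); rewrite /= -(invgK (ltr m)) divg_eq1 ltrV (inj_eq ltrI).
  by case: l m => s e [t e'] /=; rewrite xpair_eqE; case: e e' => [] [].
have redE u : reduced (map f u) =
    sorted (fun l m => ~~ ((l.1 == m.1) && (l.2 != m.2))) u.
  by rewrite /reduced sorted_map; apply: eq_sorted => l m /=; rewrite -fE.
have prodE u : wprod (map f u) = \prod_(l <- u) ltr l by rewrite /wprod big_map.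
have mapE w : w = map f (map g w).
  by rewrite -map_comp -[LHS]map_id; apply: eq_map => a /=; rewrite gK.
have [u [[ru pu] uu]] := fb x; exists (map f u); split.
  by rewrite redE prodE.
move=> w; rewrite (mapE w) redE prodE => h; congr map; exact: uu h.
Qed.

Lemma redword_reduced x : reduced (redword x).
Proof.
rewrite /redword; case: xgetP => [w _ []//|no].
by case: (reduced_word_uniq x) => w [/no].
Qed.

Lemma redwordK x : wprod (redword x) = x.
Proof.
rewrite /redword; case: xgetP => [w _ []//|no].
by case: (reduced_word_uniq x) => w [/no].
Qed.

Lemma wprodK w : reduced w -> redword (wprod w) = w.
Proof.
move=> rw; have [v [_ uv]] := reduced_word_uniq (wprod w).
transitivity v; last exact: uv.
by symmetry; apply: uv; split; [exact: redword_reduced|exact: redwordK].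
Qed.

Lemma wprod_cat u w : wprod (u ++ w) = wprod u * wprod w.
Proof. by rewrite /wprod big_cat. Qed.

Lemma wprod_cons a w : wprod (a :: w) = val a * wprod w.
Proof. by rewrite /wprod big_cons. Qed.

Lemma wprod_rcons w a : wprod (rcons w a) = wprod w * val a.
Proof. by rewrite -cats1 wprod_cat /wprod big_seq1. Qed.

Lemma reduced_rcons w a b :
  reduced (rcons (rcons w a) b) = reduced (rcons w a) && (val a * val b != 1).
Proof.
by case: w => [|c w] /=; rewrite /reduced /= ?andbT ?rcons_path ?last_rcons.
Qed.

Lemma reduced_catl u w : reduced (u ++ w) -> reduced u.
Proof. by case: u => //= a u; rewrite /reduced /= cat_path => /andP[]. Qed.

Lemma wlen_mulP x a b : ends_with a x ->
  (wlen (x * val b) == (wlen x).+1) = (val a * val b != 1).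
Proof.
move=> [w xw].
have rw : reduced (rcons w a) by rewrite -xw redword_reduced.
have xE : x = wprod (rcons w a) by rewrite -xw redwordK.
rewrite /wlen xw; have [e|ne] := eqVneq (val a * val b) 1; last first.
  rewrite xE -wprod_rcons wprodK ?reduced_rcons ?rw //.
  by rewrite !size_rcons eqxx.
have -> : x * val b = wprod w by rewrite xE wprod_rcons -mulgA e mulg1.
rewrite wprodK; first by rewrite size_rcons -[X in X == _]addn0 -addn2 eqn_add2l.
by apply: (@reduced_catl w [:: a]); rewrite cats1.
Qed.

Lemma redword_mul x b a : ends_with a x -> wlen (x * val b) = (wlen x).+1 ->
  redword (x * val b) = rcons (redword x) b.
Proof.
move=> ea /eqP; rewrite (wlen_mulP _ ea) => ab; case: ea => w xw.
rewrite -[x in LHS]redwordK -wprod_rcons wprodK// xw reduced_rcons ab andbT -xw.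
exact: redword_reduced.
Qed.

Lemma ends_with_mul x b a : ends_with a x -> wlen (x * val b) = (wlen x).+1 ->
  ends_with b (x * val b).
Proof. by move=> ea /(redword_mul ea) e; exists (redword x). Qed.

Lemma ends_with_ex x : (0 < wlen x)%N -> exists a, ends_with a x.
Proof.
by rewrite /wlen /ends_with; case/lastP: (redword x) => // w a _; exists a, w.
Qed.

Lemma ends_with_inj x a b : ends_with a x -> ends_with b x -> a = b.
Proof. by move=> [w e] [v]; rewrite e => /rcons_inj[]. Qed.

Lemma wprod_catE v w : reduced w -> (size v <= size w)%N ->
  exists u, reduced (u ++ drop (size v) w) /\
    wprod (u ++ drop (size v) w) = wprod v * wprod w.
Proof.
move=> rw; elim: v => [|a v IH] vw.
  by exists [::]; rewrite drop0 /wprod big_nil mul1g.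
have [|u [ru pu]] := IH; first exact: ltnW.
rewrite wprod_cons -mulgA -pu /= in vw *.
case: (drop _ w) (drop_nth a vw) ru {pu} => // _ _ [-> ->] ru.
set t := drop _ w in ru *; set c := nth _ _ _ in ru *.
case: u ru => [|d u] /= ru.
  have [e|ne] := eqVneq (val a * val c) 1.
    exists [::] => /=; split; first exact: path_sorted ru.
    by rewrite wprod_cons mulgA e mul1g.
  by exists [:: a; c]; rewrite /reduced /= ne; split => //; rewrite !wprod_cons.
have [e|ne] := eqVneq (val a * val d) 1.
  exists (rcons u c); rewrite cat_rcons; split; first exact: path_sorted ru.
  by rewrite wprod_cons mulgA e mul1g.
exists [:: a, d & rcons u c]; rewrite /= cat_rcons /reduced /= ne.
by split => //; rewrite !wprod_cons.
Qed.

Lemma wlen_translate x : exists N, forall y a, (N <= wlen y)%N ->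
  ends_with a y -> ends_with a (x * y) /\
  forall b, (wlen (x * y * val b) == (wlen (x * y)).+1) =
            (wlen (y * val b) == (wlen y).+1).
Proof.
exists (wlen x).+1 => y a lxy ea.
have eaxy : ends_with a (x * y).
  have [u [ru pu]] := wprod_catE (redword_reduced y) (ltnW lxy).
  rewrite !redwordK in pu; rewrite /ends_with -pu wprodK//.
  move: ea lxy => [w wE]; rewrite /wlen wE size_rcons ltnS => lxw.
  by rewrite drop_rcons// -rcons_cat; eexists.
by split=> // b; rewrite (wlen_mulP _ ea) (wlen_mulP _ eaxy).
Qed.

Lemma wlen_translate_ge x N : exists M, forall y,
  (M <= wlen y)%N -> (N <= wlen (x * y))%N.
Proof.
exists (wlen x + N)%N => y le_y.
have [|u [ru pu]] := wprod_catE (v := redword x) (redword_reduced y).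
  exact: leq_trans (leq_addr _ _) le_y.
rewrite !redwordK in pu; rewrite /wlen -pu wprodK// size_cat size_drop.
by rewrite (leq_trans _ (leq_addl _ _))// leq_subRL ?(leq_trans _ le_y)// leq_addr.
Qed.

Fixpoint rwords n : seq (seq A) := if n is n'.+1 then
    [seq rcons w a | w <- rwords n',
                     a <- [seq a <- enum {: A} | reduced (rcons w a)]]
  else [:: [::]].

Lemma mem_rwords n w : (w \in rwords n) = reduced w && (size w == n).
Proof.
elim: n w => [|n IH] w /=; first by rewrite inE; case: w => //= *; rewrite andbF.
apply/allpairsPdep/andP => [[v [a [vn]]]|].
  rewrite mem_filter => /andP[rva _] ->; split=> //.
  by move: vn; rewrite IH size_rcons => /andP[_ /eqP ->].
case/lastP: w => [|v a] [rva]; rewrite ?size_rcons// eqSS => sv.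
exists v, a; rewrite IH sv andbT mem_filter rva mem_enum; split => //.
by apply: (@reduced_catl v [:: a]); rewrite cats1.
Qed.

Lemma rwords_uniq n : uniq (rwords n).
Proof.
elim: n => //= n IH; apply: allpairs_uniq_dep => //.
  by move=> w _; rewrite filter_uniq ?enum_uniq.
by move=> [w a] [v b] _ _ /= /rcons_inj[-> ->].
Qed.

Lemma sphereE n : [set x | wlen x = n] = [set` map wprod (rwords n)].
Proof.
apply/seteqP; split=> x /=.
  move=> xn; apply/mapP; exists (redword x); last by rewrite redwordK.
  by rewrite mem_rwords redword_reduced -xn eqxx.
move=> /mapP[w]; rewrite mem_rwords => /andP[rw /eqP sw] ->.
by rewrite /wlen wprodK.
Qed.

Lemma map_wprod_uniq n : uniq (map wprod (rwords n)).
Proof.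
rewrite map_inj_in_uniq ?rwords_uniq// => w v.
rewrite !mem_rwords => /andP[rw _] /andP[rv _] e.
by rewrite -(wprodK rw) e wprodK.
Qed.

Lemma finite_ball n : finite_set [set x | (wlen x < n)%N].
Proof.
suff -> : [set x | (wlen x < n)%N] =
    \bigcup_(i in [set i | (i < n)%N]) [set x | wlen x = i].
  apply: bigcup_finite; first exact: finite_II.
  by move=> i _; rewrite sphereE; exact: finite_seq.
by apply/seteqP; split=> x /=; [move=> xn; exists (wlen x)|case=> i /= ? ->].
Qed.

Lemma letter_ex : nonabelian -> exists a : A, True.
Proof.
move=> [x [y xy]].
have [a|noA] := pselect (exists a : A, True); first by [].
have nil (w : seq A) : w = [::] by case: w => // a; case: noA; exists a.
have e (z : G) : z = 1 by rewrite -(redwordK z) (nil (redword z)) /wprod big_nil.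
by case: xy; rewrite (e x) (e y).
Qed.

End FreeGenerators.

Section MatrixSystems.
Variables (R : realType) (G : groupType) (A : {fset G}).

(* ms_map b a is H_{ba} : V_a -> V_b *)
Record matrix_system := MatrixSystem {
  ms_space :> A -> vectType R[i];
  ms_map : forall b a : A, {linear ms_space a -> ms_space b};
  ms_map0 : forall a b : A, (val a * val b = 1)%g ->
    forall v, ms_map b a v = 0 }.

Record ip_system := IpSystem {
  ip_ms :> matrix_system;
  ip_form : forall a : A, {dot ip_ms a for @Num.conj R[i]};
  ip_formE : forall (a : A) (v : ip_ms a),
    ip_form a v v =
    \sum_(b : A) ip_form b (ms_map ip_ms b a v) (ms_map ip_ms b a v) }.

End MatrixSystems.
Arguments ip_form {R G A} i a.

Section MultiplicativeFunctions.
Variables (R : realType) (G : groupType) (A : {fset G}).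
Variable S : matrix_system R A.

Definition coprodV := {a : A & S a}.

HB.instance Definition _ := Choice.copy coprodV {a : A & S a}.

Definition inV a (v : S a) : coprodV := existT (fun b : A => S b : Type) a v.

Implicit Types (f g h : G -> coprodV).

(* the value v if u is the element v of V_a, and 0 if u lies in V_b, b != a *)
Definition component (a : A) (u : coprodV) : S a :=
  tagged_as (inV (0 : S a)) u.

Definition multiplicative_fun f := exists N, forall x a,
  (N <= wlen A x)%N -> ends_with a x ->
  tag (f x) = a /\
  forall b, wlen A (x * val b)%g = (wlen A x).+1 ->
    f (x * val b)%g = inV (ms_map S b a (component a (f x))).

Definition mult_fun := {f : G -> coprodV | `[<multiplicative_fun f>]}.

HB.instance Definition _ := Choice.copy mult_fun
  {f : G -> coprodV | `[<multiplicative_fun f>]}.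

Definition MultFun f (hf : multiplicative_fun f) : mult_fun :=
  exist (fun f => is_true `[<multiplicative_fun f>]) f (asboolT hf).

Definition mult_eq (f g : mult_fun) : bool :=
  `[<finite_set [set x | val f x <> val g x]>].

Lemma mult_eq_refl : reflexive mult_eq.
Proof.
move=> f; apply/asboolP.
by apply: (sub_finite_set (B := set0)) => [x /=|]; [exact|exact: finite_set0].
Qed.

Lemma mult_eq_sym : symmetric mult_eq.
Proof.
move=> f g; apply: asbool_equiv_eq.
by split; apply: sub_finite_set => x /= ne /esym.
Qed.

Lemma mult_eq_trans : transitive mult_eq.
Proof.
move=> g f h /asboolP fg /asboolP gh; apply/asboolP.
have : finite_set ([set x | val f x <> val g x] `|` [set x | val g x <> val h x]).
  by rewrite finite_setU.
apply: sub_finite_set => x /= fh.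
have [fgx|] := pselect (val f x = val g x); last by left.
by right => ghx; apply: fh; rewrite fgx.
Qed.

Canonical mult_eq_equiv := EquivRel mult_eq mult_eq_refl mult_eq_sym mult_eq_trans.

(* The hypotheses are arguments because the vector space structure below
   depends on them *)
Definition Hinf of nonabelian G & symmetric_free A : Type :=
  {eq_quot mult_eq_equiv}.

End MultiplicativeFunctions.

Section Hinf.
Variables (R : realType) (G : groupType) (A : {fset G}).
Hypotheses (hG : nonabelian G) (hA : symmetric_free A).
Variable S : matrix_system R A.
Implicit Types (f g h : G -> coprodV S) (p q r : mult_fun S).

Local Notation Q := (Hinf S hG hA).

HB.instance Definition _ := Choice.on Q.
HB.instance Definition _ := EqQuotient.on Q.

Lemma component_inV a (v : S a) : component a (inV v) = v.
Proof. by rewrite /component (@tagged_asE _ (fun b : A => S b : Type)). Qed.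

Lemma inV_component a (u : coprodV S) : tag u = a -> u = inV (component a u).
Proof. by case: u => b v /= <-; rewrite component_inV. Qed.

Lemma mult_funP f : multiplicative_fun f <-> exists N, forall x a,
  (N <= wlen A x)%N -> ends_with a x -> exists v : S a, f x = inV v /\
  forall b, wlen A (x * val b)%g = (wlen A x).+1 ->
    f (x * val b)%g = inV (ms_map S b a v).
Proof.
split=> -[N hN]; exists N => x a Nx xa.
  have [ta hb] := hN x a Nx xa; exists (component a (f x)).
  by split => //; exact: inV_component.
by have [v [fx hb]] := hN x a Nx xa; rewrite fx; split=> //; rewrite component_inV.
Qed.

Lemma mult_fun_ev p : exists N, forall x a,
  (N <= wlen A x)%N -> ends_with a x -> exists v : S a, val p x = inV v /\
  forall b, wlen A (x * val b)%g = (wlen A x).+1 ->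
    val p (x * val b)%g = inV (ms_map S b a v).
Proof. by apply/mult_funP; exact/asboolP/(valP p). Qed.

Lemma mult_eqP p q : mult_eq p q <->
  exists N, forall x, (N <= wlen A x)%N -> val p x = val q x.
Proof.
split=> [/asboolP fin|[N hN]].
  have [s sE] := (finite_seqP _).1 fin.
  exists (\max_(x <- s) wlen A x).+1 => x lx.
  have [//|ne] := pselect (val p x = val q x).
  have xs : x \in s by have : [set` s] x by rewrite -sE.
  by move: lx; rewrite ltnNge leq_bigmax_seq.
apply/asboolP; apply: sub_finite_set (finite_ball hA N) => x /= ne.
by rewrite ltnNge; apply/negP => /hN.
Qed.

Lemma Hinf_eqP p q : \pi_Q p = \pi_Q q <->
  exists N, forall x, (N <= wlen A x)%N -> val p x = val q x.
Proof. by rewrite -mult_eqP; split=> [/eqmodP|h]; [|apply/eqmodP]. Qed.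

Lemma Hinf_eqI p q : (exists N, forall x (a : A), (N <= wlen A x)%N ->
  ends_with a x -> val p x = val q x) -> \pi_Q p = \pi_Q q.
Proof.
move=> [N hN]; apply/Hinf_eqP; exists N.+1 => x Nx.
have [a xa] := ends_with_ex (leq_trans (ltn0Sn _) Nx).
exact: (hN x a (ltnW Nx) xa).
Qed.

Definition coprodV_add (u v : coprodV S) : coprodV S :=
  inV (tagged u + component (tag u) v).

Lemma coprodV_addE a (u v : S a) : coprodV_add (inV u) (inV v) = inV (u + v).
Proof. by rewrite /coprodV_add /= component_inV. Qed.

Definition coprodV_scale (c : R[i]) (u : coprodV S) : coprodV S :=
  inV (c *: tagged u).

Definition zero_letter : A := projT1 (cid (letter_ex hA hG)).

Lemma mult_fun_add_subproof p q :
  multiplicative_fun (fun x => coprodV_add (val p x) (val q x)).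
Proof.
apply/mult_funP.
have [N hN] := mult_fun_ev p; have [M hM] := mult_fun_ev q.
exists (maxn N M) => x a; rewrite geq_max => /andP[Nx Mx] xa.
have [v [pv pb]] := hN x a Nx xa; have [w [qw qb]] := hM x a Mx xa.
exists (v + w); rewrite pv qw coprodV_addE; split=> // b xb.
by rewrite pb// qb// coprodV_addE linearD.
Qed.

Definition mult_fun_add p q : mult_fun S :=
  MultFun (mult_fun_add_subproof p q).

Lemma mult_fun_scale_subproof c p :
  multiplicative_fun (fun x => coprodV_scale c (val p x)).
Proof.
apply/mult_funP; have [N hN] := mult_fun_ev p.
exists N => x a Nx xa; have [v [pv pb]] := hN x a Nx xa.
exists (c *: v); rewrite pv; split=> // b xb.
by rewrite pb// linearZ.
Qed.

Definition mult_fun_scale c p : mult_fun S :=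
  MultFun (mult_fun_scale_subproof c p).

Lemma mult_fun_zero_subproof : multiplicative_fun
  (fun x => inV (0 : S (last zero_letter (redword A x)))).
Proof.
apply/mult_funP; exists 0%N => x a _ xa.
have lastE y b : ends_with b y -> inV (0 : S (last zero_letter (redword A y))) =
    inV (0 : S b).
  by move=> [w ->]; rewrite last_rcons.
exists 0; rewrite (lastE _ a)//; split=> // b xb.
by rewrite (lastE _ b) ?linear0//; exact: ends_with_mul hA _ _ _ xa xb.
Qed.

Definition mult_fun_zero : mult_fun S := MultFun mult_fun_zero_subproof.

(* (pi(x) f)(y) = f(x^{-1} y) *)
Lemma mult_fun_translate_subproof z p :
  multiplicative_fun (fun x => val p (z^-1 * x)%g).
Proof.
apply/mult_funP; have [N hN] := mult_fun_ev p.
have [M1 hM1] := wlen_translate hA (z^-1)%g.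
have [M2 hM2] := wlen_translate_ge hA (z^-1)%g N.
exists (maxn M1 M2) => x a; rewrite geq_max => /andP[x1 x2] xa.
have [zxa zxb] := hM1 x a x1 xa.
have [v [pv pb]] := hN _ a (hM2 x x2) zxa.
by exists v; split=> // b /eqP; rewrite -zxb => /eqP xb; rewrite mulgA pb.
Qed.

Definition mult_fun_translate z p : mult_fun S :=
  MultFun (mult_fun_translate_subproof z p).

Definition Hinf_zero : Q := \pi_Q mult_fun_zero.
Definition Hinf_add (F1 F2 : Q) : Q := \pi_Q (mult_fun_add (repr F1) (repr F2)).
Definition Hinf_scale c (F : Q) : Q := \pi_Q (mult_fun_scale c (repr F)).
Definition Hinf_translate z (F : Q) : Q := \pi_Q (mult_fun_translate z (repr F)).

Lemma repr_piP p : exists N, forall x, (N <= wlen A x)%N ->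
  val (repr (\pi_Q p)) x = val p x.
Proof. by apply/Hinf_eqP; rewrite reprK. Qed.

Lemma pi_add p q : Hinf_add (\pi_Q p) (\pi_Q q) = \pi_Q (mult_fun_add p q).
Proof.
apply/Hinf_eqP; have [N hN] := repr_piP p; have [M hM] := repr_piP q.
exists (maxn N M) => x; rewrite geq_max => /andP[Nx Mx] /=.
by rewrite hN// hM.
Qed.

Lemma pi_scale c p : Hinf_scale c (\pi_Q p) = \pi_Q (mult_fun_scale c p).
Proof.
apply/Hinf_eqP; have [N hN] := repr_piP p.
by exists N => x Nx /=; rewrite hN.
Qed.

Lemma pi_translate z p :
  Hinf_translate z (\pi_Q p) = \pi_Q (mult_fun_translate z p).
Proof.
apply/Hinf_eqP; have [N hN] := repr_piP p.
have [M hM] := wlen_translate_ge hA (z^-1)%g N.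
by exists M => x Mx /=; rewrite hN// hM.
Qed.

Lemma Hinf_addA : associative Hinf_add.
Proof.
elim/quotW=> p; elim/quotW=> q; elim/quotW=> r.
rewrite (pi_add q r) (pi_add p q) !pi_add.
apply: Hinf_eqI.
have [N1 h1] := mult_fun_ev p; have [N2 h2] := mult_fun_ev q.
have [N3 h3] := mult_fun_ev r.
exists (maxn N1 (maxn N2 N3)) => x a; rewrite !geq_max => /and3P[x1 x2 x3] xa /=.
have [u [-> _]] := h1 x a x1 xa; have [v [-> _]] := h2 x a x2 xa.
have [w [-> _]] := h3 x a x3 xa.
by rewrite !coprodV_addE addrA.
Qed.

Lemma Hinf_addC : commutative Hinf_add.
Proof.
elim/quotW=> p; elim/quotW=> q; rewrite !pi_add; apply: Hinf_eqI.
have [N1 h1] := mult_fun_ev p; have [N2 h2] := mult_fun_ev q.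
exists (maxn N1 N2) => x a; rewrite !geq_max => /andP[x1 x2] xa /=.
have [u [-> _]] := h1 x a x1 xa; have [v [-> _]] := h2 x a x2 xa.
by rewrite !coprodV_addE addrC.
Qed.

Lemma Hinf_add0 : left_id Hinf_zero Hinf_add.
Proof.
elim/quotW=> p; rewrite pi_add; apply: Hinf_eqI.
have [N hN] := mult_fun_ev p; exists N => x a Nx xa /=.
have [u [-> _]] := hN x a Nx xa; case: xa => w ->.
by rewrite last_rcons coprodV_addE add0r.
Qed.

Lemma Hinf_addN : left_inverse Hinf_zero (Hinf_scale (-1)) Hinf_add.
Proof.
elim/quotW=> p; rewrite (pi_scale _ p) pi_add; apply: Hinf_eqI.
have [N hN] := mult_fun_ev p; exists N => x a Nx xa /=.
have [u [-> _]] := hN x a Nx xa; case: xa => w ->.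
by rewrite last_rcons coprodV_addE scaleN1r addNr.
Qed.

HB.instance Definition _ := GRing.isZmodule.Build Q
  Hinf_addA Hinf_addC Hinf_add0 Hinf_addN.

Lemma Hinf_scaleA c d (F : Q) :
  Hinf_scale c (Hinf_scale d F) = Hinf_scale (c * d) F.
Proof.
elim/quotW: F => p; rewrite (pi_scale d p) !pi_scale; apply: Hinf_eqI.
have [N hN] := mult_fun_ev p; exists N => x a Nx xa /=.
by have [u [-> _]] := hN x a Nx xa; rewrite /coprodV_scale /= scalerA.
Qed.

Lemma Hinf_scale1 : left_id 1 Hinf_scale.
Proof.
elim/quotW=> p; rewrite !pi_scale; apply: Hinf_eqI.
have [N hN] := mult_fun_ev p; exists N => x a Nx xa /=.
by have [u [-> _]] := hN x a Nx xa; rewrite /coprodV_scale /= scale1r.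
Qed.

Lemma Hinf_scaleDr : right_distributive Hinf_scale +%R.
Proof.
move=> c; elim/quotW=> p; elim/quotW=> q.
rewrite [_ + _](pi_add p q) pi_scale (pi_scale c p) (pi_scale c q) [RHS]pi_add; apply: Hinf_eqI.
have [N1 h1] := mult_fun_ev p; have [N2 h2] := mult_fun_ev q.
exists (maxn N1 N2) => x a; rewrite !geq_max => /andP[x1 x2] xa /=.
have [u [-> _]] := h1 x a x1 xa; have [v [-> _]] := h2 x a x2 xa.
by rewrite !coprodV_addE /coprodV_scale /= scalerDr.
Qed.

Lemma Hinf_scaleDl F : {morph Hinf_scale^~ F : c d / c + d}.
Proof.
move=> c d; elim/quotW: F => p; rewrite !pi_scale [RHS](pi_add (mult_fun_scale c p));  apply: Hinf_eqI.
have [N hN] := mult_fun_ev p; exists N => x a Nx xa /=.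
have [u [-> _]] := hN x a Nx xa.
by rewrite /coprodV_scale /= coprodV_addE scalerDl.
Qed.

HB.instance Definition _ := GRing.Zmodule_isLmodule.Build R[i] Q
  Hinf_scaleA Hinf_scale1 Hinf_scaleDr Hinf_scaleDl.

End Hinf.

Section HinfDot.
Variables (R : realType) (G : groupType) (A : {fset G}).
Hypotheses (hG : nonabelian G) (hA : symmetric_free A).
Variable S : ip_system R A.
Implicit Types (f g h : G -> coprodV S) (p q r : mult_fun S).

Local Notation Q := (Hinf S hG hA).

Definition sphere_form (N : nat) f g : R[i] :=
  \sum_(x \in [set x | wlen A x = N])
    \sum_(a : A | wlen A (x * val a)%g == (wlen A x).+1)
      ip_form S a (component a (f (x * val a)%g)) (component a (g (x * val a)%g)).

(* The sums over spheres are eventually constant, see Hinf_formE *)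
Definition Hinf_form (F1 F2 : Q) : R[i] :=
  xget 0 [set z | exists N0, forall N, (N0 <= N)%N ->
    sphere_form N (val (repr F1)) (val (repr F2)) = z].

Lemma wlen_rcons (w : seq A) (a : A) : reduced w ->
  (wlen A (wprod w * val a)%g == (wlen A (wprod w)).+1) = reduced (rcons w a).
Proof.
case/lastP: w => [_|w b rw].
  rewrite -wprod_rcons /wlen !wprodK//=.
rewrite (wlen_mulP hA (a := b)) ?reduced_rcons ?rw//.
by exists w; rewrite wprodK.
Qed.

Lemma sphere_formE N f g : sphere_form N f g =
  \sum_(w <- rwords A N) \sum_(a : A | reduced (rcons w a))
    ip_form S a (component a (f (wprod (rcons w a))))
                (component a (g (wprod (rcons w a)))).
Proof.
rewrite /sphere_form sphereE// -fsbig_seq ?map_wprod_uniq// big_map.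
rewrite big_seq [RHS]big_seq; apply: eq_bigr => w.
rewrite mem_rwords => /andP[rw _].
by apply: eq_big => [a|a _]; rewrite ?wlen_rcons// wprod_rcons.
Qed.

Lemma sphere_form_ext f g f' g' N0 :
  (forall x, (N0 <= wlen A x)%N -> f x = f' x) ->
  (forall x, (N0 <= wlen A x)%N -> g x = g' x) ->
  forall N, (N0 <= N)%N -> sphere_form N f g = sphere_form N f' g'.
Proof.
move=> ff gg N N0N; rewrite !sphere_formE big_seq [RHS]big_seq.
apply: eq_bigr => w; rewrite mem_rwords => /andP[rw /eqP sw].
apply: eq_bigr => a rwa; suff le : (N0 <= wlen A (wprod (rcons w a)))%N.
  by rewrite ff// gg.
by rewrite /wlen wprodK// size_rcons sw (leq_trans N0N).
Qed.

Lemma big_rwordsS N (F : seq A -> R[i]) : \sum_(w <- rwords A N.+1) F w =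
  \sum_(w <- rwords A N) \sum_(a : A | reduced (rcons w a)) F (rcons w a).
Proof.
rewrite /= big_allpairs_dep; apply: eq_bigr => w _.
by rewrite big_filter big_enum_cond.
Qed.

Lemma ip_formE2 (a : A) (u v : S a) : ip_form S a u v =
  \sum_(b : A) ip_form S b (ms_map S b a u) (ms_map S b a v).
Proof.
pose D (x y : S a) := ip_form S a x y -
  \sum_(b : A) ip_form S b (ms_map S b a x) (ms_map S b a y).
have D0 x : D x x = 0 by rewrite /D -ip_formE subrr.
have DDl x y z : D (x + y) z = D x z + D y z.
  rewrite /D linearDl addrACA -opprD -big_split /=; congr (_ - _).
  by apply: eq_bigr => b _; rewrite linearD linearDl.
have DDr x y z : D z (x + y) = D z x + D z y.
  rewrite /D linearDr addrACA -opprD -big_split /=; congr (_ - _).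
  by apply: eq_bigr => b _; rewrite linearD linearDr.
have DZl c x y : D (c *: x) y = c * D x y.
  rewrite /D linearZl_LR mulrBr mulr_sumr; congr (_ - _).
  by apply: eq_bigr => b _; rewrite linearZ linearZl_LR.
have DZr c x y : D x (c *: y) = c^* * D x y.
  rewrite /D linearZr_LR mulrBr mulr_sumr; congr (_ - _).
  by apply: eq_bigr => b _; rewrite linearZ linearZr_LR.
have DC x y : D x y + D y x = 0.
  by have := D0 (x + y); rewrite DDl !DDr !D0 add0r addr0.
have := DC u ('i *: v); rewrite DZl DZr conjCi mulNr addrC -mulrBr => /eqP.
rewrite mulf_eq0 (negPf (neq0Ci _)) /= subr_eq0 => /eqP e.
have := DC u v; rewrite e -mulr2n => /eqP; rewrite mulrn_eq0 /= => /eqP D0'.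
by apply/eqP; rewrite -subr_eq0; apply/eqP; exact: D0'.
Qed.

Lemma sphere_form_const p q : exists N0, forall N, (N0 <= N)%N ->
  sphere_form N (val p) (val q) = sphere_form N0 (val p) (val q).
Proof.
have [N1 h1] := mult_fun_ev p; have [N2 h2] := mult_fun_ev q.
exists (maxn N1 N2); elim=> [|N IH]; first by rewrite leqn0 => /eqP ->.
rewrite leq_eqVlt => /predU1P[<-//|]; rewrite ltnS => le_N; rewrite -IH//.
rewrite !sphere_formE big_rwordsS big_seq [RHS]big_seq.
apply: eq_bigr => w; rewrite mem_rwords => /andP[rw /eqP sw].
apply: eq_bigr => a rwa; set x := wprod (rcons w a).
have xE : redword A x = rcons w a by rewrite wprodK.
have xa : ends_with a x by exists w.
have xN : wlen A x = N.+1 by rewrite /wlen xE size_rcons sw.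
move: le_N; rewrite geq_max => /andP[le1 le2].
have [|u [px pb]] := h1 x a _ xa; first by rewrite xN (leq_trans le1).
have [|v [qx qb]] := h2 x a _ xa; first by rewrite xN (leq_trans le2).
rewrite px qx !component_inV ip_formE2 [RHS](bigID (fun b : A =>
  reduced (rcons (rcons w a) b))) /= [X in _ + X]big1 ?addr0 => [|b].
  apply: eq_bigr => b; rewrite wprod_rcons -/x => rb.
  have xb : wlen A (x * val b)%g = (wlen A x).+1.
    by apply/eqP; rewrite wlen_rcons.
  by rewrite pb// qb// !component_inV.
rewrite reduced_rcons rwa /= negbK => /eqP ab.
by rewrite !ms_map0// linear0l.
Qed.

Lemma Hinf_formE p q : exists N0, forall N, (N0 <= N)%N ->
  sphere_form N (val p) (val q) = Hinf_form (\pi_Q p) (\pi_Q q).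
Proof.
have [M1 e1] := repr_piP hG hA p; have [M2 e2] := repr_piP hG hA q.
have [N0 cN] := sphere_form_const (repr (\pi_Q p)) (repr (\pi_Q q)).
have [N1 fN] : exists N1, forall N, (N1 <= N)%N ->
    sphere_form N (val (repr (\pi_Q p))) (val (repr (\pi_Q q))) =
    Hinf_form (\pi_Q p) (\pi_Q q).
  rewrite /Hinf_form; case: xgetP => [z _ //|/(_ _) no].
  by case: (no _ (ex_intro _ N0 cN)).
exists (maxn N1 (maxn M1 M2)) => N; rewrite geq_max => /andP[le1 le2].
rewrite -(fN _ le1); symmetry; apply: (sphere_form_ext _ _ le2) => x.
  by rewrite geq_max => /andP[/e1].
by rewrite geq_max => /andP[_ /e2].
Qed.

Lemma Hinf_form_linearl (F : Q) :
  GRing.linear_for *%R (fun F' => Hinf_form F' F).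
Proof.
move=> c F1 F2; elim/quotW: F => r; elim/quotW: F1 => p; elim/quotW: F2 => q.
rewrite [_ *: _](pi_scale hG hA c p) [_ + _](pi_add hG hA (mult_fun_scale c p) q).
have [N1 h1] := Hinf_formE p r; have [N2 h2] := Hinf_formE q r.
have [N3 h3] := Hinf_formE (mult_fun_add (mult_fun_scale c p) q) r.
have [M1 e1] := mult_fun_ev p; have [M2 e2] := mult_fun_ev q.
pose N := maxn N1 (maxn N2 (maxn N3 (maxn M1 M2))).
have : (N <= N)%N by [].
rewrite {1}/N !geq_max => /and5P[l1 l2 l3 l4 l5].
rewrite -(h1 _ l1) -(h2 _ l2) -(h3 _ l3) !sphere_formE.
rewrite mulr_sumr -big_split /= big_seq [RHS]big_seq.
apply: eq_bigr => w; rewrite mem_rwords => /andP[rw /eqP sw].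
rewrite mulr_sumr -big_split /=; apply: eq_bigr => a rwa.
set x := wprod (rcons w a).
have xE : redword A x = rcons w a by rewrite wprodK.
have xa : ends_with a x by exists w.
have xN : wlen A x = N.+1 by rewrite /wlen xE size_rcons sw.
have [|u [-> _]] := e1 x a _ xa; first by rewrite xN (leq_trans l4).
have [|v [-> _]] := e2 x a _ xa; first by rewrite xN (leq_trans l5).
by rewrite coprodV_addE !component_inV linearPl.
Qed.

Lemma Hinf_formC (F1 F2 : Q) : Hinf_form F1 F2 = (Hinf_form F2 F1)^*.
Proof.
elim/quotW: F1 => p; elim/quotW: F2 => q.
have [N1 h1] := Hinf_formE p q; have [N2 h2] := Hinf_formE q p.
rewrite -(h1 (maxn N1 N2)) ?leq_maxl// -(h2 (maxn N1 N2)) ?leq_maxr//.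
rewrite !sphere_formE rmorph_sum; apply: eq_bigr => w _.
rewrite rmorph_sum; apply: eq_bigr => a _.
by rewrite [LHS]hermC expr0 mul1r.
Qed.

Lemma Hinf_form_linearr (F : Q) :
  GRing.linear_for (Num.conj \; *%R) (Hinf_form F).
Proof.
move=> c F1 F2.
by rewrite Hinf_formC Hinf_form_linearl rmorphD rmorphM /= -!Hinf_formC.
Qed.

Lemma Hinf_form_gt0 (F : Q) : F != 0 -> 0 < Hinf_form F F.
Proof.
elim/quotW: F => p p0.
have [N1 h1] := Hinf_formE p p; have [M1 e1] := mult_fun_ev p.
have ip_ge0 a (v : S a) : 0 <= ip_form S a v v.
  have [->|v0] := eqVneq v 0; first by rewrite linear0l.
  exact/ltW/neq0_dnorm_gt0.
have sum_ge0 w : 0 <= \sum_(a : A | reduced (rcons w a))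
    ip_form S a (component a (val p (wprod (rcons w a))))
                (component a (val p (wprod (rcons w a)))).
  by apply: sumr_ge0.
rewrite lt_neqAle; apply/andP; split; last first.
  by rewrite -(h1 N1)// sphere_formE sumr_ge0.
apply: contra_neq p0 => F0.
rewrite -[LHS]/(\pi_Q p); apply: Hinf_eqI; exists (maxn N1 M1).+1 => x a le_x xa.
have [|u [px _]] := e1 x a _ xa.
  by rewrite (leq_trans (leq_maxr N1 M1)) ?(ltnW le_x).
have [w xw] := xa; rewrite px /= xw last_rcons; congr inV.
have xE : x = wprod (rcons w a) by rewrite -xw redwordK.
have rwa : reduced (rcons w a) by rewrite -xw; exact: redword_reduced.
have sw : (maxn N1 M1 <= size w)%N by move: le_x; rewrite /wlen xw size_rcons.
have := h1 (size w); rewrite (leq_trans (leq_maxl N1 M1) sw) -F0 sphere_formE.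
move=> /(_ isT) /eqP; rewrite psumr_eq0 // => /allP /(_ w).
rewrite mem_rwords eqxx andbT (reduced_catl (w := [:: a])) ?cats1// => /(_ isT).
rewrite psumr_eq0 // => /allP /(_ a).
rewrite mem_index_enum rwa -xE px component_inV => /(_ isT) /eqP u0.
have [//|un0] := eqVneq u 0.
have : 0 < ip_form S a u u by exact/neq0_dnorm_gt0.
by rewrite u0 ltxx.
Qed.

HB.instance Definition _ := bilinear_isBilinear.Build R[i] Q Q R[i]
  *%R (Num.conj \; *%R) Hinf_form (Hinf_form_linearl, Hinf_form_linearr).
HB.instance Definition _ := isHermitianSesquilinear.Build R[i] Q false
  Num.conj Hinf_form (fun F1 F2 => etrans (Hinf_formC F1 F2) (esym (mul1r _))).
HB.instance Definition _ := isDotProduct.Build R[i] Q Hinf_form Hinf_form_gt0.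

Definition Hinf_dot : {dot Q for @Num.conj R[i]} := Hinf_form.

End HinfDot.

Section HilbertSpaces.
Variable R : realType.

(* Inner products are linear in the first variable *)
Record hilbert := Hilbert {
  hilbert_space :> completeNormedModType R[i];
  hdot : {dot hilbert_space for @Num.conj R[i]};
  hdot_norm : forall x, `|x| ^+ 2 = hdot x x }.

Arguments hdot h : clear implicits.

(* Unique up to a unique unitary operator commuting with the maps cpl_map *)
Record completion (E : lmodType R[i]) (d : {dot E for @Num.conj R[i]}) :=
  Completion {
    cpl_space :> hilbert;
    cpl_map : {linear E -> cpl_space};
    cpl_isometry : forall u v, hdot cpl_space (cpl_map u) (cpl_map v) = d u v;
    cpl_dense : dense (range cpl_map) }.

Definition unitary_operator (H K : hilbert) (U : H -> K) :=
  [/\ linear U, bijective U & forall u v, hdot K (U u) (U v) = hdot H u v].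

Definition unitary_rep (G : groupType) (H : hilbert) (rho : G -> H -> H) :=
  [/\ forall x, unitary_operator (rho x),
      forall v, rho 1%g v = v &
      forall x y v, rho (x * y)%g v = rho x (rho y v)].

Definition subspace (H : hilbert) (M : set H) :=
  [/\ M 0, forall u v, M u -> M v -> M (u + v) &
      forall c u, M u -> M (c *: u)].

End HilbertSpaces.
Arguments cpl_map {R E d} c.

Section Mult.
Variables (R : realType) (G : groupType) (hG : nonabelian G).

(* K carrying pi is H(V_a, H_{ba}, B_a), the image of cpl_map K being the
   copy of H^oo in it; pi is determined by its values on that image *)
Definition Mult (A : {fset G}) (hA : symmetric_free A)
    (H : hilbert R) (rho : G -> H -> H) : Prop :=
  unitary_rep rho /\
  exists (S : ip_system R A) (K : completion (Hinf_dot hG hA S))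
         (pi : G -> K -> K),
    [/\ unitary_rep pi,
        forall x F, pi x (cpl_map K F) = cpl_map K (Hinf_translate x F) &
        exists (M : set H) (U : H -> K),
          [/\ subspace M, dense M, unitary_operator U,
              U @` M = range (cpl_map K) &
              forall m x, M m -> U (rho x m) = pi x (U m)]].

Definition MultGroup (H : hilbert R) (rho : G -> H -> H) : Prop :=
  exists (A : {fset G}) (hA : symmetric_free A), Mult hA rho.

End Mult.

(* Main.v *)
Require Import Defs.
From HB Require Import structures.
From mathcomp Require Import all_boot all_order all_algebra finmap.
From mathcomp Require Import generic_quotient sesquilinear complex.
From mathcomp Require Import all_classical all_reals all_analysis.
Set Implicit Arguments.
Unset Strict Implicit.
Unset Printing Implicit Defensive.
Import Order.TTheory GRing.Theory Num.Theory.
Local Open Scope classical_set_scope.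
Local Open Scope ring_scope.
Local Open Scope quotient_scope.

(** Both assertions follow from one statement: if phi is an automorphism of
    Gamma and pi belongs to Mult(F_{A'}), then pi o phi belongs to Mult(F_A).
    Let E = H^oo be the space of multiplicative functions realizing pi over A'.
    For x in Gamma, phi maps the set of elements whose A-reduced word starts
    with that of x onto a set that is almost invariant under right translation,
    so multiplying by its indicator function defines a projection P_x of E.
    For a letter a of A, let V_a be the space of the elements of P_a E that are
    represented by functions multiplicative, with respect to A', at all points
    phi v where v starts with a and has A-length at least a fixed constant.
    Because phi changes lengths in a controlled way, multiplicativity at such a
    point survives left translation by phi u as long as u v is reduced, so
    H_{ba} F = pi(phi a)^-1 P_{ab} F maps V_a to V_b, and for every F in E and
    all x = w a long enough P_x F lies in pi(phi w) V_a. Since F is the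
    orthogonal sum of the P_x F over a sphere, F |-> (x |-> pi(phi w)^-1 P_x F)
    identifies E with the space H^oo of the system (V_a, H_{ba}) over A, with
    the forms B_a inherited from E. *)

(** * Finite-dimensional subspaces of a vector space *)

(** An injective parametrization into [V] of maximal rank is onto, since a missed vector would
    extend it; ranks are bounded by [m]. Coordinates form a relation because they will be read off a
    representative that is not unique. *)
Lemma finite_dim_param (K : fieldType) (E : lmodType K) (V : set E) (m : nat)
    (coords : E -> 'rV[K]_m -> Prop) :
  V 0 -> (forall c u v, V u -> V v -> V (c *: u + v)) ->
  (forall c u v a b, coords u a -> coords v b ->
     coords (c *: u + v) (c *: a + b)) ->
  (forall u, V u -> exists a, coords u a) ->
  (forall u, V u -> coords u 0 -> u = 0) ->
  exists n (f : {linear 'rV[K]_n -> E}), injective f /\ range f = V.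
Proof.
move=> V0 VL cL cV c0.
have coords0 : coords 0 0.
  have [a /[dup] ha /(cL (-1) _ _ _ _ ha)] := cV 0 V0.
  by rewrite !scaleN1r oppr0 addr0 addNr.
pose param n := exists f : {linear 'rV[K]_n -> E}, injective f /\ range f `<=` V.
have bound n : `[< param n >] -> (n <= m)%N.
  move=> /asboolP[f [fI fV]].
  have fP (c : 'rV_n) : V (f c) by apply: fV; exists c.
  have [a ha] := choice (fun i => cV _ (fP (delta_mx 0 i))).
  have {}ha (c : 'rV_n) : coords (f c) (c *m \matrix_i a i).
    rewrite mulmx_sum_row [X in f X]row_sum_delta linear_sum /=.
    apply: (big_ind2 coords) => //.
      by move=> u x v y ux vy; have := cL 1 _ _ _ _ ux vy; rewrite !scale1r.
    move=> i _; rewrite linearZ rowK /=.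
    by have := cL (c 0 i) _ _ _ _ (ha i) coords0; rewrite !addr0.
  (* A row vector c killed by the matrix gives [f c] zero coordinates, hence [f c = 0] and c = 0. *)
  suff /eqP <- : row_free (\matrix_i a i) by exact: rank_leq_col.
  apply: inj_row_free => c cM; apply: fI; rewrite linear0.
  by apply: c0 => //; rewrite -cM.
have ex0 : exists n, `[< param n >].
  exists 0%N; apply/asboolP; exists \0; split; last by move=> _ [c _ <-].
  by move=> c d _; rewrite (thinmx0 c) (thinmx0 d).
case: (ex_maxnP ex0 bound) => n /asboolP[f [fI fV]] nmax.
exists n, f; split => //; apply/seteqP; split=> // v Vv.
have [//|nfv] := pselect (range f v).
suff : `[< param n.+1 >] by move=> /nmax; rewrite ltnn.
apply/asboolP.
pose g (c : 'rV[K]_(1 + n)) := lsubmx c 0 0 *: v + f (rsubmx c).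
have gL : linear g.
  move=> k c d; rewrite /g !linearD !linearZ /= !mxE.
  by rewrite scalerDl scalerA (mulrC k) addrACA.
pose gM := GRing.isLinear.Build K 'rV[K]_(1 + n) E *:%R g gL.
pose G : {linear 'rV[K]_(1 + n) -> E} := HB.pack g gM.
exists G; split=> [|_ [c _ <-]]; last first.
  by apply: VL => //; apply: fV; exists (@rsubmx _ 1 1 n c).
(* If the coefficient of v in a kernel vector were nonzero, v would lie in the range of f. *)
apply: raddf_inj => c0n; move: (c0n : 'rV_(1 + n)) => c gc0.
have cE : lsubmx c 0 0 = 0.
  apply: contrapT => /eqP cn0; apply: nfv.
  exists (- (lsubmx c 0 0)^-1 *: rsubmx c) => //.
  move/eqP: gc0; rewrite /= /g addrC addr_eq0 => /eqP e.
  by rewrite linearZ /= e scalerN scaleNr opprK scalerA mulVf ?scale1r.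
move: gc0; rewrite /= /g cE scale0r add0r -(linear0 f) => /fI r0.
rewrite -(hsubmxK c) r0; suff -> : lsubmx c = 0 by rewrite row_mx0.
by apply/matrixP => i j; rewrite !ord1 cE mxE.
Qed.

(** * Inner products pulled back along injective maps *)

Section PullDot.
Variables (R : realType) (U E : lmodType R[i]) (d : {dot E for @Num.conj R[i]}).
Variables (f : {linear U -> E}).

(** Injectivity is an argument so that the inner product structure, whose positivity rests on it,
    can be attached to this term. *)
Definition pull_form of injective f := fun u v : U => d (f u) (f v).

Hypothesis fI : injective f.
Local Notation pull := (pull_form fI).

Lemma pull_linearl (v : U) : GRing.linear_for *%R (fun u => pull u v).
Proof. by move=> c x y; rewrite /pull_form linearP linearPl. Qed.

Lemma pull_linearr (u : U) : GRing.linear_for (Num.conj \; *%R) (pull u).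
Proof. by move=> c x y; rewrite /pull_form linearP linearPr. Qed.

Lemma pull_hermitian (u v : U) : pull u v = (-1) ^+ false * (pull v u)^*.
Proof. by rewrite /pull_form [LHS]hermC. Qed.

Lemma pull_gt0 (u : U) : u != 0 -> 0 < pull u u.
Proof.
move=> u0; apply: neq0_dnorm_gt0.
by apply: contra_neq u0; rewrite -(linear0 f) => /fI.
Qed.

HB.instance Definition _ := bilinear_isBilinear.Build R[i] U U R[i]
  *%R (Num.conj \; *%R) pull (pull_linearl, pull_linearr).
HB.instance Definition _ := isHermitianSesquilinear.Build R[i] U false
  Num.conj pull pull_hermitian.
HB.instance Definition _ := isDotProduct.Build R[i] U pull pull_gt0.

Definition pull_dot : {dot U for @Num.conj R[i]} := pull.

Lemma pull_dotE u v : pull_dot u v = d (f u) (f v).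
Proof. by []. Qed.

End PullDot.

(** * Further facts on reduced words *)

Section Words.
Variables (G : groupType) (A : {fset G}).
Hypothesis hA : symmetric_free A.
Implicit Types (a b : A) (x y g : G).

Lemma big_rwordsS_nmod (V : nmodType) n (F : seq A -> V) :
  \sum_(w <- rwords A n.+1) F w =
  \sum_(w <- rwords A n) \sum_(a : A | reduced (rcons w a)) F (rcons w a).
Proof.
rewrite /= big_allpairs_dep; apply: eq_bigr => w _.
by rewrite big_filter big_enum_cond.
Qed.

Lemma redword1 : redword A 1%g = [::].
Proof. by rewrite -(wprodK hA (w := [::]))// /wprod big_nil. Qed.

Lemma redword_letter a : redword A (val a) = [:: a].
Proof. by rewrite -(wprodK hA (w := [:: a]))// /wprod big_seq1. Qed.

Lemma ends_with_letter a : ends_with a (val a).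
Proof. by exists [::]; rewrite redword_letter. Qed.

Lemma mem_redword_rwords n x : wlen A x = n -> redword A x \in rwords A n.
Proof. by move=> xn; rewrite mem_rwords redword_reduced// -xn /wlen eqxx. Qed.

Lemma wlen_wprod n w : w \in rwords A n -> wlen A (wprod w) = n.
Proof. by rewrite mem_rwords /wlen => /andP[rw /eqP <-]; rewrite wprodK. Qed.

Lemma ends_with_wprod w a : reduced (rcons w a) -> ends_with a (wprod (rcons w a)).
Proof. by move=> rw; exists w; rewrite wprodK. Qed.

(** Unlike [redword_mul], this covers x = 1, which ends with no letter. *)
Lemma redword_extend x b : wlen A (x * val b)%g = (wlen A x).+1 ->
  redword A (x * val b)%g = rcons (redword A x) b.
Proof.
have [x0|x0] := posnP (wlen A x); last first.
  by have [a xa] := ends_with_ex x0; exact: redword_mul xa.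
have -> : x = 1%g.
  rewrite -(redwordK hA x); move: x0; rewrite /wlen; case: redword => //.
  by rewrite /wprod big_nil.
by rewrite mul1g redword1 redword_letter.
Qed.

Lemma ends_with_extend x b : wlen A (x * val b)%g = (wlen A x).+1 ->
  ends_with b (x * val b)%g.
Proof. by move=> /redword_extend e; exists (redword A x). Qed.

Lemma ends_with_split x a : ends_with a x -> (1 < wlen A x)%N ->
  exists y (c : A), [/\ ends_with c y, x = (y * val a)%g & wlen A x = (wlen A y).+1].
Proof.
move=> [w xw]; have := redword_reduced hA x; rewrite /wlen xw size_rcons ltnS => rw.
case/lastP: w xw rw => // w c xw rw _.
have rwc : reduced (rcons w c) by apply: (@reduced_catl _ _ _ [:: a]); rewrite cats1.
exists (wprod (rcons w c)), c; split; first exact: ends_with_wprod.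
  by rewrite -wprod_rcons -xw redwordK.
by rewrite wprodK.
Qed.

Lemma wlen_letter2 a b : (val a * val b)%g != 1%g ->
  wlen A (val a * val b)%g = (wlen A (val a)).+1.
Proof. by move=> ab; apply/eqP; rewrite (wlen_mulP hA _ (ends_with_letter a)). Qed.

End Words.

(** * The matrix system built from an abstract family of projections *)

Section ConeSystem.
Variables (R : realType) (G : groupType) (A : {fset G}).
Hypotheses (hG : nonabelian G) (hA : symmetric_free A).
Variables (E : lmodType R[i]) (d : {dot E for @Num.conj R[i]}).
(** [tau g] stands for pi(phi g), [P x] for P_x and [V a] for V_a. The hypotheses on [P] say that
    each sphere yields an orthogonal decomposition of [E], refined by the next sphere and compatible
    with translations that keep the last letter. *)
Variables (tau P : G -> {linear E -> E}) (V : A -> set E).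
Implicit Types (a b c : A) (x y g : G) (F : E).

Hypothesis tau1 : forall F, tau 1%g F = F.
Hypothesis tauM : forall x y F, tau (x * y)%g F = tau x (tau y F).
Hypothesis tau_iso : forall x F1 F2, d (tau x F1) (tau x F2) = d F1 F2.
Hypothesis P_tau : forall a g x F, ends_with a x -> ends_with a (g * x)%g ->
  tau g (P x F) = P (g * x)%g (tau g F).
Hypothesis P_nest : forall x b F, wlen A (x * val b)%g = (wlen A x).+1 ->
  P (x * val b)%g (P x F) = P (x * val b)%g F.
Hypothesis P_idem : forall x F, P x (P x F) = P x F.
Hypothesis P_orth : forall x y F, wlen A x = wlen A y -> x <> y ->
  P x (P y F) = 0.
Hypothesis P_sep : forall n F, (forall x, wlen A x = n -> P x F = 0) -> F = 0.
Hypothesis P_adj : forall x F1 F2, d (P x F1) F2 = d F1 (P x F2).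
Hypothesis V_param : forall a,
  exists n (f : {linear 'rV[R[i]]_n -> E}), injective f /\ range f = V a.
Hypothesis V_P : forall a F, V a F -> P (val a) F = F.
Hypothesis V_step : forall a b F, V a F -> (val a * val b)%g != 1%g ->
  V b (tau (val a)^-1%g (P (val a * val b)%g F)).
Hypothesis V_ev : forall F, exists N, forall x a, (N <= wlen A x)%N ->
  ends_with a x -> V a (tau (x * (val a)^-1)^-1%g (P x F)).

Lemma P_sum n F : \sum_(w <- rwords A n) P (wprod w) F = F.
Proof.
apply/eqP; rewrite -subr_eq0; apply/eqP/(@P_sep n) => x xn.
rewrite linearB linear_sum /=; apply/eqP; rewrite subr_eq0; apply/eqP.
rewrite (bigD1_seq (redword A x)) ?mem_redword_rwords ?rwords_uniq //=.
rewrite redwordK// P_idem big_seq_cond big1 ?addr0// => w /andP[wn wx].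
apply: P_orth; first by rewrite (wlen_wprod hA wn).
move=> e; move: wx; rewrite e wprodK ?eqxx//.
by move: wn; rewrite mem_rwords => /andP[].
Qed.

(** Decompose [P x F] over the next sphere: a term at w b with w different from x vanishes, because
    P_{wb} P_x = P_{wb} P_w P_x = 0. *)
Lemma P_split x F : P x F =
  \sum_(b : A | wlen A (x * val b)%g == (wlen A x).+1) P (x * val b)%g F.
Proof.
rewrite -{1}(P_sum (wlen A x).+1 (P x F)) big_rwordsS_nmod.
rewrite (bigD1_seq (redword A x)) ?mem_redword_rwords ?rwords_uniq //=.
rewrite [X in _ + X]big_seq_cond [X in _ + X]big1 ?addr0 => [|w /andP[wn wx]].
  apply: eq_big => [b|b rb].
    by rewrite -(wlen_rcons hA) ?redword_reduced// redwordK.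
  rewrite wprod_rcons redwordK// P_nest//; apply/eqP.
  by move: rb; rewrite -(wlen_rcons hA) ?redword_reduced// redwordK.
have rw : reduced w by move: wn; rewrite mem_rwords => /andP[].
apply: big1 => b rb; rewrite wprod_rcons -P_nest; last first.
  by apply/eqP; rewrite wlen_rcons.
rewrite (P_orth (x := wprod w)) ?linear0// ?(wlen_wprod hA wn)// => e.
by move: wx; rewrite -e wprodK// eqxx.
Qed.

Lemma d_sum n F1 F2 :
  d F1 F2 = \sum_(w <- rwords A n) d (P (wprod w) F1) (P (wprod w) F2).
Proof.
rewrite -{1}(P_sum n F1) linear_sumlz; apply: eq_bigr => w _.
by rewrite -P_adj P_idem.
Qed.

Definition cone_dim a : nat := projT1 (cid (V_param a)).
Definition cone_emb a : {linear 'rV[R[i]]_(cone_dim a) -> E} :=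
  projT1 (cid (projT2 (cid (V_param a)))).

Lemma cone_embP a : injective (cone_emb a) /\ range (cone_emb a) = V a.
Proof. exact: projT2 (cid (projT2 (cid (V_param a)))). Qed.

Lemma cone_emb_inj a : injective (cone_emb a).
Proof. by case: (cone_embP a). Qed.

Lemma cone_embV a v : V a (cone_emb a v).
Proof. by case: (cone_embP a) => _ <-; exists v. Qed.

Lemma cone_emb_surj a F : V a F -> exists v, cone_emb a v = F.
Proof. by case: (cone_embP a) => _ <- [v _ vF]; exists v. Qed.

(** The values lie in [V b] by [V_step], so they lift through [cone_emb b]; its injectivity makes
    the lift linear. *)
Lemma cone_map_ex b a :
  exists h : {linear 'rV[R[i]]_(cone_dim a) -> 'rV[R[i]]_(cone_dim b)},
  ((val a * val b)%g = 1%g -> forall v, h v = 0) /\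
  ((val a * val b)%g != 1%g -> forall v, cone_emb b (h v) =
    tau (val a)^-1%g (P (val a * val b)%g (cone_emb a v))).
Proof.
have [ab|ab] := eqVneq (val a * val b)%g 1%g; first by exists \0.
have [h hE] := choice (fun v => cone_emb_surj (V_step (cone_embV v) ab)).
have hL : linear h.
  by move=> k u v; apply: cone_emb_inj; rewrite linearP !hE !linearP.
pose hM := GRing.isLinear.Build R[i] 'rV[R[i]]_(cone_dim a)
  'rV[R[i]]_(cone_dim b) *:%R h hL.
pose H : {linear 'rV[R[i]]_(cone_dim a) -> 'rV[R[i]]_(cone_dim b)} :=
  HB.pack h hM.
by exists H; split=> // e; rewrite e eqxx in ab.
Qed.

Definition cone_map b a := projT1 (cid (cone_map_ex b a)).

Lemma cone_map0 a b : (val a * val b)%g = 1%g -> forall v, cone_map b a v = 0.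
Proof. by case: (projT2 (cid (cone_map_ex b a))). Qed.

Lemma cone_mapE a b v : (val a * val b)%g != 1%g -> cone_emb b (cone_map b a v) =
  tau (val a)^-1%g (P (val a * val b)%g (cone_emb a v)).
Proof. by case: (projT2 (cid (cone_map_ex b a))) => _ + ab; apply. Qed.

Definition cone_ms : matrix_system R A :=
  @MatrixSystem R G A (fun a => 'rV[R[i]]_(cone_dim a)) cone_map cone_map0.

Definition cone_form a : {dot cone_ms a for @Num.conj R[i]} :=
  pull_dot d (@cone_emb_inj a).

(** Pythagoras: an element of V_a is fixed by P_a, hence is the orthogonal sum of its parts under
    the P_{ab}, which the isometric translation carries to the H_{ba} v. *)
Lemma cone_formE a (v : cone_ms a) : cone_form a v v =
  \sum_(b : A) cone_form b (ms_map cone_ms b a v) (ms_map cone_ms b a v).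
Proof.
rewrite [LHS]pull_dotE -{1}(V_P (cone_embV v)) P_split linear_sumlz.
rewrite [RHS](bigID (fun b : A => (val a * val b)%g != 1%g)) /=.
rewrite [X in _ = _ + X]big1 ?addr0 => [|b /negPn/eqP ab]; last first.
  by rewrite cone_map0// linear0l.
under eq_bigl => b do rewrite (wlen_mulP hA _ (ends_with_letter hA a)).
by apply: eq_bigr => b ab; rewrite pull_dotE cone_mapE// tau_iso -P_adj P_idem.
Qed.

Definition cone_system : ip_system R A := IpSystem cone_formE.

Local Notation S := cone_system.
Local Notation Q := (Hinf S hG hA).

(** For x = w a this is pi(phi w) v, the part in P_x E of the vector encoded by the value v at x. *)
Definition cone_iota a x (v : S a) : E := tau (x * (val a)^-1)%g (cone_emb a v).

Lemma cone_iota_inj a x : injective (@cone_iota a x).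
Proof.
move=> u v /(congr1 (tau (x * (val a)^-1)^-1%g)).
by rewrite /cone_iota -!tauM mulVg !tau1 => /cone_emb_inj.
Qed.

Lemma P_iota a x (v : S a) : ends_with a x -> P x (cone_iota x v) = cone_iota x v.
Proof.
move=> xa; rewrite /cone_iota -{1}(mulgVK (val a) x).
rewrite -(P_tau (a := a)) ?mulgVK//; last exact: ends_with_letter.
by rewrite (V_P (cone_embV v)).
Qed.

Lemma iota_form a x (u v : S a) :
  d (cone_iota x u) (cone_iota x v) = ip_form S a u v.
Proof. by rewrite tau_iso. Qed.

(** Under [cone_iota], the rule f(xb) = H_{ba} f(x) becomes restriction by P_{xb}. Translation by x
    a^-1 takes ab to xb, both ending with b, so [P_tau] applies. *)
Lemma iota_step a b x (v : S a) : ends_with a x ->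
  wlen A (x * val b)%g = (wlen A x).+1 ->
  P (x * val b)%g (cone_iota x v) = cone_iota (x * val b)%g (ms_map S b a v).
Proof.
move=> xa xb.
have ab : (val a * val b)%g != 1%g by rewrite -(wlen_mulP hA b xa) xb eqxx.
rewrite /cone_iota cone_mapE// mulgK -tauM.
rewrite (P_tau (a := b)); last 2 first.
- exact: (ends_with_extend hA (wlen_letter2 hA ab)).
- by rewrite mulgA mulgVK; exact: ends_with_extend.
by rewrite mulgA mulgVK.
Qed.

(* F is the element of E that f describes near infinity *)
Definition describes (f : G -> coprodV S) F := exists N, forall x a,
  (N <= wlen A x)%N -> ends_with a x ->
  P x F = cone_iota x (component a (f x)).

(** The two vectors have the same parts on one large sphere, so [P_sep] identifies them. Allowing
    two functions gives independence of the representative as well. *)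
Lemma describes_uniq (f1 f2 : G -> coprodV S) F1 F2 :
  (exists N, forall x, (N <= wlen A x)%N -> f1 x = f2 x) ->
  describes f1 F1 -> describes f2 F2 -> F1 = F2.
Proof.
move=> [N fg] [N1 h1] [N2 h2]; apply/eqP; rewrite -subr_eq0; apply/eqP.
apply: (@P_sep (maxn N (maxn N1 N2)).+1) => x xN.
have [a xa] : exists a, ends_with a x by apply: ends_with_ex; rewrite xN.
have : (maxn N (maxn N1 N2) <= wlen A x)%N by rewrite xN.
rewrite !geq_max => /and3P[le le1 le2].
by rewrite linearB /= (h1 _ _ le1 xa) (h2 _ _ le2 xa) fg// subrr.
Qed.

(** Sum the vectors encoded by the values on one sphere beyond the threshold; [iota_step] propagates
    the description outwards. *)
Lemma describes_ex (p : mult_fun S) : exists F, describes (val p) F.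
Proof.
have [N hN] := mult_fun_ev p.
pose term (x : G) : E := let a := last (zero_letter hG hA) (redword A x) in
  cone_iota x (component a (val p x)).
have termE x a : ends_with a x -> term x = cone_iota x (component a (val p x)).
  by move=> [w xw]; rewrite /term xw last_rcons.
(* The successor makes all words on the sphere nonempty, so the default letter in [term] is never
   read there; n stays opaque so that [rwords A n] is not unfolded. *)
have [n nE] : exists n, n = N.+1 by exists N.+1.
exists (\sum_(w <- rwords A n) term (wprod w)), n.
move=> x a /subnKC; move: (_ - _)%N => k.
elim: k x a => [|k IH] x a xk xa.
  rewrite addn0 in xk; rewrite linear_sum /=.
  rewrite (bigD1_seq (redword A x)) ?mem_redword_rwords ?rwords_uniq //=.
  rewrite redwordK// (termE x a)// P_iota// big_seq_cond.
  rewrite big1 ?addr0// => w /andP[wn wx].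
  have [c wc] : exists c, ends_with c (wprod w).
    by apply: ends_with_ex; rewrite (wlen_wprod hA wn) nE.
  rewrite (termE _ _ wc) -(P_iota _ wc) P_orth ?(wlen_wprod hA wn)//.
  move=> e; move: wx; rewrite e wprodK ?eqxx//.
  by move: wn; rewrite mem_rwords => /andP[].
(* Pass to the parent y of x: P_x F = P_x P_y F, and P_y F is known by induction. *)
have [|y [c [yc xE xy]]] := ends_with_split hA xa; first by rewrite -xk nE addnS.
have yk : (n + k)%N = wlen A y by apply: succn_inj; rewrite -xy -xk addnS.
rewrite xE in xy *; rewrite -P_nest// (IH y c)// iota_step//.
have [|v [-> /(_ a xy) ->]] := hN y c _ yc; last by rewrite !component_inV.
by rewrite -yk nE (leq_trans (leqnSn N))// leq_addr.
Qed.

Lemma describes_surj F : exists p : mult_fun S, describes (val p) F.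
Proof.
have [N hN] := V_ev F.
(* The choice bears on letter and vector together, as the type of the vector depends on the letter;
   the default can occur only at short x. *)
pose f x : coprodV S := xget (inV (0 : S (zero_letter hG hA)))
  [set u : coprodV S | ends_with (tag u) x /\ P x F = cone_iota x (tagged u)].
have fE x a : (N <= wlen A x)%N -> ends_with a x ->
    exists2 v : S a, f x = inV v & P x F = cone_iota x v.
  move=> xN xa; have [v vE] := cone_emb_surj (hN x a xN xa).
  have Pv : P x F = cone_iota x (v : S a).
    by rewrite /cone_iota vE -tauM mulgV tau1.
  rewrite /f; case: xgetP => [[c u] _ /= [xc Pu]|/(_ (inV (v : S a)))]; last first.
    by case; split.
  by move: u Pu; rewrite (ends_with_inj xc xa) => u Pu; exists u.
have fm : multiplicative_fun f.
  apply/mult_funP; exists N => x a xN xa; have [v fx Pv] := fE x a xN xa.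
  exists v; split=> // b xb; have xbb := ends_with_extend hA xb.
  have [|u -> Pu] := fE _ _ _ xbb; first by rewrite xb (leqW xN).
  congr inV; apply: (@cone_iota_inj b (x * val b)%g).
  by rewrite -Pu -iota_step// -Pv P_nest.
exists (MultFun fm), N => x a xN xa /=.
by have [v -> ->] := fE x a xN xa; rewrite component_inV.
Qed.

Lemma describes_linear (k : R[i]) (p q : mult_fun S) F1 F2 :
  describes (val p) F1 -> describes (val q) F2 ->
  describes (val (mult_fun_add (mult_fun_scale k p) q)) (k *: F1 + F2).
Proof.
move=> [N1 h1] [N2 h2]; have [M1 e1] := mult_fun_ev p.
have [M2 e2] := mult_fun_ev q.
exists (maxn N1 (maxn N2 (maxn M1 M2))) => x a.
rewrite !geq_max => /and4P[l1 l2 l3 l4] xa.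
rewrite linearP (h1 _ _ l1 xa) (h2 _ _ l2 xa).
rewrite -[val (mult_fun_add _ _) x]/(coprodV_add
  (coprodV_scale k (val p x)) (val q x)).
have [u [-> _]] := e1 x a l3 xa; have [v [-> _]] := e2 x a l4 xa.
by rewrite /coprodV_scale coprodV_addE !component_inV /cone_iota !linearP.
Qed.

Lemma describes_translate g (p : mult_fun S) F : describes (val p) F ->
  describes (val (mult_fun_translate hA g p)) (tau g F).
Proof.
move=> [N h]; have [M1 hM1] := wlen_translate hA (g^-1)%g.
have [M2 hM2] := wlen_translate_ge hA (g^-1)%g N.
exists (maxn M1 M2) => x a; rewrite geq_max => /andP[x1 x2] xa /=.
have [ga _] := hM1 x a x1 xa.
rewrite -{1}(mulVKg g x) -(P_tau (a := a)) ?mulVKg//.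
by rewrite (h _ _ (hM2 x x2) ga) /cone_iota -tauM !mulgA mulgV mul1g.
Qed.

Lemma describes_form (p q : mult_fun S) F1 F2 :
  describes (val p) F1 -> describes (val q) F2 ->
  Hinf_dot hG hA S (\pi_Q p) (\pi_Q q) = d F1 F2.
Proof.
move=> [N1 h1] [N2 h2]; have [N hN] := Hinf_formE hG hA p q.
pose n := maxn N (maxn N1 N2); have : (n <= n)%N by [].
rewrite {1}/n !geq_max => /and3P[le le1 le2].
transitivity (sphere_form n (val p) (val q)); first by rewrite (hN n).
(* The sphere form of index n evaluates functions at points x a of length n + 1. *)
rewrite sphere_formE// (d_sum n.+1) big_rwordsS_nmod.
rewrite big_seq [RHS]big_seq; apply: eq_bigr => w wn.
apply: eq_bigr => a rwa; have xa := ends_with_wprod hA rwa.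
have xn : wlen A (wprod (rcons w a)) = n.+1.
  rewrite /wlen wprodK// size_rcons; congr _.+1; apply/eqP.
  by move: wn; rewrite mem_rwords => /andP[].
by rewrite (h1 _ a) ?(h2 _ a) ?iota_form ?xn ?(leqW le1) ?(leqW le2).
Qed.

Lemma cone_system_iso :
  exists (S0 : ip_system R A) (T : {linear Hinf S0 hG hA -> E}),
  [/\ forall f1 f2, d (T f1) (T f2) = Hinf_dot hG hA S0 f1 f2,
      range T = setT &
      forall g (f : Hinf S0 hG hA), T (Hinf_translate g f) = tau g (T f)].
Proof.
exists S.
(* T sends a class to the vector that its chosen representative describes. *)
have [T hT] := choice (fun f : Q => describes_ex (repr f)).
have piT p F : describes (val p) F -> T (\pi_Q p) = F.
  by move=> pF; apply: describes_uniq pF; [exact: (repr_piP hG hA p)|exact: hT].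
have TL : linear T.
  move=> k f g; rewrite -[in LHS](reprK f) -[in LHS](reprK g).
  rewrite [k *: _](Defs.pi_scale hG hA k) [X in T X](Defs.pi_add hG hA).
  by apply: piT; apply: describes_linear.
pose TM := GRing.isLinear.Build R[i] Q E *:%R T TL.
pose TT : {linear Q -> E} := HB.pack T TM.
exists TT; split=> [f g||g f] /=.
- by rewrite -[in RHS](reprK f) -[in RHS](reprK g); symmetry; apply: describes_form.
- apply/seteqP; split=> // F _; have [p pF] := describes_surj F.
  by exists (\pi_Q p) => //=; exact: piT.
- rewrite -[in LHS](reprK f) pi_translate; apply: piT.
  exact: describes_translate.
Qed.

End ConeSystem.

(** * Cones of elements whose reduced words share a prefix *)

Section Cones.
Variables (G : groupType) (A : {fset G}).
Hypothesis hA : symmetric_free A.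
Implicit Types (a b : A) (x y v g : G).

Definition cone x v := prefix (redword A x) (redword A v).

Lemma cone_wlen x v : cone x v -> (wlen A x <= wlen A v)%N.
Proof. exact: size_prefix. Qed.

Lemma cone_extend x b v : wlen A (x * val b)%g = (wlen A x).+1 ->
  cone (x * val b)%g v -> cone x v.
Proof.
move=> xb; rewrite /cone redword_extend//.
by apply: prefix_trans; exact: prefix_rcons.
Qed.

Lemma cone_uniq x y v : wlen A x = wlen A y -> cone x v -> cone y v -> x = y.
Proof.
rewrite /cone !prefixE /wlen => -> /eqP xv /eqP yv.
by rewrite -(redwordK hA x) -xv yv redwordK.
Qed.

Lemma take_reduced n (w : seq A) : reduced w -> reduced (take n w).
Proof. by rewrite -{1}(cat_take_drop n w) => /reduced_catl. Qed.

Lemma cone_cover n v : (n <= wlen A v)%N -> exists2 x, wlen A x = n & cone x v.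
Proof.
move=> nv; have rv := take_reduced n (redword_reduced hA v).
exists (wprod (take n (redword A v))); first by rewrite /wlen wprodK// size_takel.
by rewrite /cone wprodK ?prefix_take.
Qed.

Lemma redword_cone x b v : ends_with b x -> cone (val b) v ->
  exists2 s, x = (wprod s * val b)%g &
    redword A (wprod s * v)%g = s ++ redword A v.
Proof.
move=> [s xs]; rewrite /cone (redword_letter hA) => /prefixP[t vt].
exists s; first by rewrite -wprod_rcons -xs redwordK.
have rv := redword_reduced hA v; have rx := redword_reduced hA x.
rewrite -[in LHS](redwordK hA v) -wprod_cat wprodK//.
move: rx rv; rewrite xs vt /= -cat_rcons /reduced.
case: s {xs} => //= c s; rewrite cat_path => -> /=.
by rewrite last_rcons.
Qed.

(** Write x = s a, g x = s' a and v = x t. Then g v = s' a t is reduced, since reducedness concerns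
    adjacent letters only and those of a t already occur in v. *)
Lemma cone_mull g a x v : ends_with a x -> ends_with a (g * x)%g ->
  cone x v -> cone (g * x)%g (g * v)%g.
Proof.
move=> [s xs] [s' gxs]; rewrite /cone xs gxs => /prefixP[t vt].
have rv := redword_reduced hA v; have rgx := redword_reduced hA (g * x)%g.
suff -> : redword A (g * v)%g = rcons s' a ++ t by exact: prefix_prefix.
rewrite -[LHS](wprodK hA) ?redword_reduced// redwordK//.
have -> : (g * v)%g = wprod (rcons s' a ++ t).
  rewrite wprod_cat -gxs redwordK// -[in LHS](redwordK hA v) vt wprod_cat -xs.
  by rewrite redwordK// mulgA.
rewrite wprodK//; move: rgx rv; rewrite gxs vt /reduced.
case: s {xs vt} => [|c s] /=.
  by case: s' {gxs} => //= c' s'; rewrite cat_path => -> /=; rewrite last_rcons.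
rewrite cat_path last_rcons => + /andP[_ tp].
by case: s' {gxs} => //= c' s'; rewrite cat_path => -> /=; rewrite last_rcons.
Qed.

Lemma cone_translate g a x v : ends_with a x -> ends_with a (g * x)%g ->
  cone (g * x)%g (g * v)%g = cone x v.
Proof.
move=> xa gxa; apply/idP/idP; last exact: cone_mull xa gxa.
move=> /(cone_mull (g := g^-1%g) (a := a)); rewrite !mulKg; exact.
Qed.

(** Right multiplication by a letter appends one letter or removes the last one, so it leaves
    shorter prefixes alone. *)
Lemma cone_mul_letter x a v : (wlen A x < wlen A v)%N ->
  cone x (v * val a)%g = cone x v /\ (wlen A v <= (wlen A (v * val a)%g).+1)%N.
Proof.
move=> xv; have pr u (w : seq A) c : (size u <= size w)%N ->
    prefix u (rcons w c) = prefix u w.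
  by move=> uw; rewrite !prefixE -cats1 takel_cat.
have v0 : (0 < wlen A v)%N by exact: leq_trans xv.
have [c [w vw]] := ends_with_ex v0; have rv := redword_reduced hA v.
rewrite vw in rv; have vE : v = wprod (rcons w c) by rewrite -vw redwordK.
have [ca|ca] := eqVneq (val c * val a)%g 1%g.
  have vaE : redword A (v * val a)%g = w.
    rewrite vE wprod_rcons -mulgA ca mulg1 wprodK//.
    by apply: (@reduced_catl _ _ _ [:: c]); rewrite cats1.
  move: xv; rewrite /cone /wlen vaE vw size_rcons ltnS => xv.
  by rewrite pr.
have vaE : redword A (v * val a)%g = rcons (redword A v) a.
  by rewrite -vw in vE rv; rewrite vE -wprod_rcons !wprodK// vw reduced_rcons -vw rv.
by rewrite /cone /wlen vaE size_rcons pr ?leqW//; exact: ltnW.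
Qed.

Lemma cone_mulr x g : exists N, forall v, (N <= wlen A v)%N ->
  cone x (v * g)%g = cone x v.
Proof.
rewrite -(redwordK hA g); elim: (redword A g) => [|a s [N hN]].
  by exists 0%N => v _; rewrite /wprod big_nil mulg1.
(* The first letter of g may shorten v by one, hence [N.+1]. *)
exists (maxn N.+1 (wlen A x).+1) => v; rewrite geq_max => /andP[Nv xv].
have [<- va] := cone_mul_letter a xv.
by rewrite wprod_cons mulgA hN// -ltnS (leq_trans Nv).
Qed.

Lemma cone_mulr_fin (X : choiceType) (B : {fset X}) (f : B -> G) x :
  exists N, forall v (b : B), (N <= wlen A v)%N -> cone x (v * f b)%g = cone x v.
Proof.
have [N hN] := choice (fun b : B => cone_mulr x (f b)).
exists (\max_b N b) => v b le_v; apply: hN.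
by apply: leq_trans le_v; exact: leq_bigmax.
Qed.

(** An injection pulls a finite ball back to a finite set, which lies in some ball. *)
Lemma wlen_proper (B : {fset G}) (f : G -> G) N : symmetric_free B ->
  injective f -> exists M, forall v, (M <= wlen A v)%N -> (N <= wlen B (f v))%N.
Proof.
move=> hB fI.
have : finite_set (f @^-1` [set x | (wlen B x < N)%N]).
  by apply: finite_preimage; [by move=> ? ? _ _ /fI|exact: finite_ball].
move=> /finite_seqP[s sE].
exists (\max_(v <- s) wlen A v).+1 => v; apply: contraTT.
rewrite -!ltnNge ltnS => fv.
by apply: leq_bigmax_seq => //; have : [set` s] v by rewrite -sE.
Qed.

End Cones.

(** * Cutting multiplicative functions over A' along images of A-cones *)

Section Cutting.
Variables (R : realType) (G : groupType) (A A' : {fset G}).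
Hypotheses (hG : nonabelian G) (hA : symmetric_free A) (hA' : symmetric_free A').
Variables (phi : {multiplicative G -> G}) (psi : G -> G).
Hypotheses (phiK : cancel phi psi) (psiK : cancel psi phi).
Variable S : ip_system R A'.
Implicit Types (a b : A) (c : A') (x y v g : G) (p q : mult_fun S).

Local Notation E := (Hinf S hG hA').
Local Notation d := (Hinf_dot hG hA' S).
Local Notation zero := (mult_fun_zero hG hA' S).

Let psiM : {morph psi : x y / (x * y)%g}.
Proof. exact: can2_gmulfM. Qed.

Let phi1 : phi 1%g = 1%g.
Proof. by apply: (mulgI (phi 1%g)); rewrite -gmulfM !mulg1. Qed.

Let phiV x : phi x^-1%g = (phi x)^-1%g.
Proof. by apply: (mulgI (phi x)); rewrite -gmulfM !mulgV. Qed.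

Lemma zeroE c y : ends_with c y -> val zero y = inV (0 : S c).
Proof. by case=> w yw; rewrite /= yw last_rcons. Qed.

Lemma psi_proper N : exists L, forall y,
  (L <= wlen A' y)%N -> (N <= wlen A (psi y))%N.
Proof. by apply: wlen_proper => //; exact: can_inj psiK. Qed.

Lemma phi_proper N : exists M, forall v,
  (M <= wlen A v)%N -> (N <= wlen A' (phi v))%N.
Proof. by apply: wlen_proper => //; exact: can_inj phiK. Qed.

Lemma cone_psi_mulr x : exists N, forall y c, (N <= wlen A' y)%N ->
  cone A x (psi (y * val c)%g) = cone A x (psi y).
Proof.
have [N hN] := cone_mulr_fin hA (fun c : A' => psi (val c)) x.
have [L hL] := psi_proper N; exists L => y c Ly.
by rewrite psiM; apply: hN; exact: hL.
Qed.

(** Values lie in a disjoint union of spaces, so [zero] supplies the zero of the space of the last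
    letter of y. *)
Definition cut_fun x p y := if cone A x (psi y) then val p y else val zero y.

Lemma cut_mult x p : multiplicative_fun (cut_fun x p).
Proof.
apply/mult_funP; have [N hN] := mult_fun_ev p; have [L hL] := cone_psi_mulr x.
exists (maxn N L) => y c; rewrite geq_max => /andP[Ny Ly] yc.
rewrite /cut_fun; have [xy|xy] := boolP (cone A x (psi y)).
  have [v [-> pb]] := hN y c Ny yc; exists v; split=> // b yb.
  by rewrite hL// xy pb.
exists 0; rewrite (zeroE yc); split=> // b yb; rewrite hL// (negPf xy).
by rewrite (zeroE (ends_with_extend hA' yb)) linear0.
Qed.

Definition cut x p : mult_fun S := MultFun (cut_mult x p).

Lemma cutE x p y :
  val (cut x p) y = if cone A x (psi y) then val p y else val zero y.
Proof. by []. Qed.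

Definition cutoff x (F : E) : E := \pi_E (cut x (repr F)).

Lemma pi_cut x p : cutoff x (\pi_E p) = \pi_E (cut x p).
Proof.
apply/Hinf_eqP; have [N hN] := repr_piP hG hA' p.
by exists N => y Ny; rewrite !cutE hN.
Qed.

Lemma cutoff_linear x : linear (cutoff x).
Proof.
move=> k; elim/quotW=> p; elim/quotW=> q.
rewrite [k *: _](Defs.pi_scale hG hA' k p) [_ + _](Defs.pi_add hG hA').
rewrite [LHS]pi_cut (pi_cut x p) (pi_cut x q).
rewrite [k *: _](Defs.pi_scale hG hA' k) [RHS](Defs.pi_add hG hA').
apply: Hinf_eqI; exists 0%N => y c _ yc.
rewrite -[RHS]/(coprodV_add (coprodV_scale k (val (cut x p) y)) (val (cut x q) y)).
rewrite !cutE; case: ifP => // _; rewrite (zeroE yc) /coprodV_scale.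
by rewrite coprodV_addE scaler0 addr0.
Qed.

HB.instance Definition _ x := GRing.isLinear.Build R[i] E E *:%R (cutoff x)
  (cutoff_linear x).

Definition ptranslate g (F : E) : E := Hinf_translate (phi g) F.

Lemma ptranslate_linear g : linear (ptranslate g).
Proof.
move=> k; elim/quotW=> p; elim/quotW=> q.
rewrite [k *: _](Defs.pi_scale hG hA' k p) [_ + _](Defs.pi_add hG hA').
rewrite /ptranslate [LHS]pi_translate (pi_translate hG hA' _ p).
rewrite (pi_translate hG hA' _ q).
rewrite [k *: _](Defs.pi_scale hG hA' k) [RHS](Defs.pi_add hG hA').
by apply: Hinf_eqI; exists 0%N.
Qed.

HB.instance Definition _ g := GRing.isLinear.Build R[i] E E *:%R (ptranslate g)
  (ptranslate_linear g).

Lemma pi_ptranslate g p :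
  ptranslate g (\pi_E p) = \pi_E (mult_fun_translate hA' (phi g) p).
Proof. exact: pi_translate. Qed.

Lemma translateE z p y : val (mult_fun_translate hA' z p) y = val p (z^-1 * y)%g.
Proof. by []. Qed.

Lemma ptranslate1 F : ptranslate 1%g F = F.
Proof.
elim/quotW: F => p; rewrite pi_ptranslate phi1; apply: Hinf_eqI.
by exists 0%N => y c _ _; rewrite translateE invg1 mul1g.
Qed.

Lemma ptranslateM x y F : ptranslate (x * y)%g F = ptranslate x (ptranslate y F).
Proof.
elim/quotW: F => p; rewrite (pi_ptranslate y) !pi_ptranslate gmulfM; apply: Hinf_eqI.
by exists 0%N => z c _ _; rewrite !translateE invgM mulgA.
Qed.

(** Left translation by phi g carries the image of the cone of x onto that of g x, and far out it
    keeps last A'-letters, hence the zeros. *)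
Lemma cutoff_ptranslate a g x F : ends_with a x -> ends_with a (g * x)%g ->
  ptranslate g (cutoff x F) = cutoff (g * x)%g (ptranslate g F).
Proof.
move=> xa gxa; elim/quotW: F => p; rewrite pi_cut !pi_ptranslate pi_cut.
have [L hL] := wlen_translate hA' (phi g)^-1%g.
apply: Hinf_eqI; exists L => y c Ly yc; rewrite cutE !translateE cutE.
have -> : cone A (g * x)%g (psi y) = cone A x (psi ((phi g)^-1 * y)%g).
  rewrite -(cone_translate hA _ xa gxa); congr cone.
  by rewrite psiM -phiV phiK mulVKg.
case: ifP => // _; have [yc' _] := hL y c Ly yc.
by rewrite (zeroE yc) (zeroE yc').
Qed.

Lemma cutoff_eq x1 x2 x F : (forall v, cone A x v = cone A x1 v && cone A x2 v) ->
  cutoff x1 (cutoff x2 F) = cutoff x F.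
Proof.
move=> xE; elim/quotW: F => p; rewrite (pi_cut x2) !pi_cut.
apply: Hinf_eqI; exists 0%N => y c _ _.
by rewrite !cutE xE; case: cone; case: cone.
Qed.

Lemma cutoff_nest x b F : wlen A (x * val b)%g = (wlen A x).+1 ->
  cutoff (x * val b)%g (cutoff x F) = cutoff (x * val b)%g F.
Proof.
move=> xb; apply: cutoff_eq => v.
by have [/(cone_extend hA xb) ->|] := boolP (cone A (x * val b)%g v).
Qed.

Lemma cutoff_idem x F : cutoff x (cutoff x F) = cutoff x F.
Proof. by apply: cutoff_eq => v; rewrite andbb. Qed.

Lemma cutoff_orth x y F : wlen A x = wlen A y -> x <> y ->
  cutoff x (cutoff y F) = 0.
Proof.
move=> lxy xy; elim/quotW: F => p; rewrite (pi_cut y) pi_cut.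
apply: Hinf_eqI; exists 0%N => z c _ _.
rewrite !cutE; case: ifP => // xz; case: ifP => // yz.
by case: xy; exact: cone_uniq xz yz.
Qed.

(** The cones of the words of length n cover all elements of length at least n, and psi y is that
    long for y far out. *)
Lemma cutoff_sep n F : (forall x, wlen A x = n -> cutoff x F = 0) -> F = 0.
Proof.
elim/quotW: F => p h.
have hw w : exists N, w \in rwords A n -> forall y, (N <= wlen A' y)%N ->
    val (cut (wprod w) p) y = val zero y.
  have [wn|_] := boolP (w \in rwords A n); last by exists 0%N.
  have := h _ (wlen_wprod hA wn); rewrite pi_cut => /Hinf_eqP[N hN].
  by exists N.
have [N hN] := choice hw; have [L hL] := psi_proper n.
apply: Hinf_eqI; exists (maxn L (\max_(w <- rwords A n) N w)) => y c.
rewrite geq_max => /andP[Ly Ny] _; have [x xn xy] := cone_cover hA (hL y Ly).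
have wn := mem_redword_rwords hA xn.
have := hN _ wn y (leq_trans (leq_bigmax_seq _ wn isT) Ny).
by rewrite redwordK// cutE xy.
Qed.

Lemma cutoff_adj x F1 F2 : d (cutoff x F1) F2 = d F1 (cutoff x F2).
Proof.
elim/quotW: F1 => p; elim/quotW: F2 => q; rewrite !pi_cut.
have [N1 h1] := Hinf_formE hG hA' (cut x p) q.
have [N2 h2] := Hinf_formE hG hA' p (cut x q).
transitivity (sphere_form (maxn N1 N2) (val (cut x p)) (val q)).
  by rewrite h1// leq_maxl.
transitivity (sphere_form (maxn N1 N2) (val p) (val (cut x q))); last first.
  by rewrite h2// leq_maxr.
rewrite !sphere_formE//; apply: eq_bigr => w _; apply: eq_bigr => c rwc.
rewrite !cutE; case: ifP => // _.
by rewrite (zeroE (ends_with_wprod hA' rwc)) component_inV linear0l linear0r.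
Qed.

(* The condition of the definition of multiplicative functions at the point y *)
Definition mult_at (f : G -> coprodV S) y := forall c, ends_with c y ->
  exists v : S c, f y = inV v /\
  forall c', wlen A' (y * val c')%g = (wlen A' y).+1 ->
    f (y * val c')%g = inV (ms_map S c' c v).

Lemma deep_ex : exists M, (forall v, (M <= wlen A v)%N ->
  (forall a c, ends_with c (phi v) -> ends_with c (phi (val a * v)%g) /\
    forall c', (wlen A' (phi (val a * v)%g * val c')%g ==
                (wlen A' (phi (val a * v)%g)).+1) =
               (wlen A' (phi v * val c')%g == (wlen A' (phi v)).+1)) /\
  (forall a c, cone A (val a) (v * psi (val c))%g = cone A (val a) v)).
Proof.
have [K hK] := choice (fun a : A => wlen_translate hA' (phi (val a))).
have [M hM] := phi_proper (\max_a K a).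
have [L hL] := choice (fun a : A =>
  cone_mulr_fin hA (fun c : A' => psi (val c)) (val a)).
exists (maxn M (\max_a L a)) => v; rewrite geq_max => /andP[Mv Lv].
split=> a c; last by apply: hL; apply: leq_trans Lv; exact: leq_bigmax.
by rewrite gmulfM; apply: hK; apply: leq_trans (hM _ Mv); exact: leq_bigmax.
Qed.

(* Beyond this A-length, left multiplication by phi of a letter of A changes
   neither the last A'-letter nor the cancellation on the right, and right
   multiplication by a letter of A' does not leave the cones of the letters. *)
Definition deep : nat := projT1 (cid deep_ex).

Lemma deep_mul a c v : (deep <= wlen A v)%N -> ends_with c (phi v) ->
  ends_with c (phi (val a * v)%g) /\
    forall c', (wlen A' (phi (val a * v)%g * val c')%g ==
                (wlen A' (phi (val a * v)%g)).+1) =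
               (wlen A' (phi v * val c')%g == (wlen A' (phi v)).+1).
Proof. by move=> /(projT2 (cid deep_ex) v)[+ _]; apply. Qed.

Lemma deep_cone a c v : (deep <= wlen A v)%N ->
  cone A (val a) (v * psi (val c))%g = cone A (val a) v.
Proof. by move=> /(projT2 (cid deep_ex) v)[]. Qed.

(** Multiply by the letters of s one at a time: without cancellation the intermediate products are
    at least as long as v, so one constant serves for every s. *)
Lemma deep_translate s v c : (deep <= wlen A v)%N -> reduced (s ++ redword A v) ->
  ends_with c (phi v) -> ends_with c (phi (wprod s * v)%g) /\
    forall c', (wlen A' (phi (wprod s * v)%g * val c')%g ==
                (wlen A' (phi (wprod s * v)%g)).+1) =
               (wlen A' (phi v * val c')%g == (wlen A' (phi v)).+1).
Proof.
move=> dv; elim: s => [|a s IH] rs vc.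
  by rewrite /wprod big_nil mul1g.
have rs' : reduced (s ++ redword A v) by apply: path_sorted rs.
have [svc svb] := IH rs' vc; rewrite wprod_cons -mulgA.
have ds : (deep <= wlen A (wprod s * v)%g)%N.
  rewrite /wlen -[X in (_ * X)%g](redwordK hA) -wprod_cat wprodK// size_cat.
  exact: leq_trans dv (leq_addl _ _).
have [asvc asvb] := deep_mul a ds svc; split=> // c'.
by rewrite asvb svb.
Qed.

(** The representative vanishes at every nonempty point off the image of the cone, not only near
    infinity; this makes its threshold of multiplicativity independent of F. *)
Definition cone_space a : set E := [set F | exists p, [/\ F = \pi_E p,
  forall y c, ~~ cone A (val a) (psi y) -> ends_with c y ->
    val p y = inV (0 : S c) &
  forall v, cone A (val a) v -> (deep <= wlen A v)%N ->
    mult_at (val p) (phi v)]].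

Lemma cutoff_cone_space a F : cone_space a F -> cutoff (val a) F = F.
Proof.
move=> [p [-> p0 _]]; rewrite pi_cut; apply: Hinf_eqI; exists 0%N => y c _ yc.
by rewrite cutE; case: ifPn => // ny; rewrite (zeroE yc) (p0 y c).
Qed.

(** With u = x b^-1, [deep_translate] carries multiplicativity of p from phi (u v) to phi v, and
    [deep_cone] keeps the neighbours of phi v on the same side of the cut. *)
Lemma cut_in_cone_space x b p : ends_with b x ->
  (forall v, cone A (val b) v -> (deep <= wlen A v)%N ->
     mult_at (val p) (phi (x * (val b)^-1 * v)%g)) ->
  cone_space b (ptranslate (x * (val b)^-1)^-1%g (cutoff x (\pi_E p))).
Proof.
move=> xb pm; set u := (x * (val b)^-1)%g in pm *.
have ux : (u^-1 * x = val b)%g by rewrite /u invgM invgK mulgVK.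
rewrite (cutoff_ptranslate _ xb); last by rewrite ux; exact: ends_with_letter.
rewrite ux pi_ptranslate pi_cut; eexists; split; first by reflexivity.
  by move=> y c ny yc; rewrite cutE (negPf ny) (zeroE yc).
move=> v bv dv c vc; have [s xs redv] := redword_cone hA xb bv.
have us : u = wprod s by rewrite /u xs mulgK.
have rs : reduced (s ++ redword A v) by rewrite -redv redword_reduced.
have [uvc uvb] := deep_translate dv rs vc; rewrite -us in uvc uvb.
have [w [pw pc]] := pm v bv dv c uvc.
rewrite cutE translateE phiK bv phiV invgK -gmulfM pw; exists w; split=> // c' vc'.
rewrite cutE translateE psiM phiK deep_cone// bv invgK mulgA -gmulfM.
by apply: pc; apply/eqP; rewrite uvb vc'.
Qed.

Lemma cone_space_step a b F : cone_space a F -> (val a * val b)%g != 1%g ->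
  cone_space b (ptranslate (val a)^-1%g (cutoff (val a * val b)%g F)).
Proof.
move=> [p [-> _ pm]] ab; have abl := wlen_letter2 hA ab.
have abb : ends_with b (val a * val b)%g by exact: ends_with_extend.
have := @cut_in_cone_space (val a * val b)%g b p abb; rewrite mulgK; apply=> v bv dv.
have [s abs redv] := redword_cone hA abb bv.
have sa : val a = wprod s by apply: (mulIg (val b)).
(* So a v is reduced as written: it lies in the cone of a and is longer than v, hence still deep. *)
have {}sa : s = [:: a].
  rewrite -(redword_letter hA a) sa wprodK//.
  by apply: (@reduced_catl _ _ _ (redword A v)); rewrite -redv redword_reduced.
rewrite sa /wprod big_seq1 in redv; apply: pm.
  by rewrite /cone redv redword_letter//= eqxx prefix0s.
by rewrite /wlen redv /= leqW.
Qed.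

(** If v starts with a, then x a^-1 v lies in the cone of x, so its length is at least that of x and
    its image under phi is beyond the threshold of p. *)
Lemma cone_space_ev F : exists N, forall x a, (N <= wlen A x)%N ->
  ends_with a x -> cone_space a (ptranslate (x * (val a)^-1)^-1%g (cutoff x F)).
Proof.
elim/quotW: F => p; have [N hN] := mult_fun_ev p; have [M hM] := phi_proper N.
exists M => x a Mx xa; apply: cut_in_cone_space => // v av dv c vc.
apply: hN => //; apply: hM; apply: leq_trans Mx _; apply: cone_wlen.
rewrite -[X in cone _ X](mulgVK (val a)) (cone_translate hA (a := a)) ?mulgVK//.
exact: ends_with_letter.
Qed.

Lemma cone_space0 a : cone_space a 0.
Proof.
exists zero; split=> // [y c _|v _ _ c vc]; first exact: zeroE.
exists 0; split=> [|c' vc']; first exact: zeroE.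
by rewrite linear0 (zeroE (ends_with_extend hA' vc')).
Qed.

Lemma cone_space_linear a (k : R[i]) F1 F2 : cone_space a F1 -> cone_space a F2 ->
  cone_space a (k *: F1 + F2).
Proof.
move=> [p [-> p0 pm]] [q [-> q0 qm]].
exists (mult_fun_add (mult_fun_scale k p) q); split=> [|y c ny yc|v av dv c vc].
- by rewrite [k *: _](Defs.pi_scale hG hA' k p) [LHS](Defs.pi_add hG hA').
- rewrite -[LHS]/(coprodV_add (coprodV_scale k (val p y)) (val q y)).
  by rewrite (p0 y c)// (q0 y c)// /coprodV_scale coprodV_addE scaler0 addr0.
have [u [pu pb]] := pm v av dv c vc; have [w [qw qb]] := qm v av dv c vc.
exists (k *: u + w); split=> [|c' vc'].
  rewrite -[LHS]/(coprodV_add (coprodV_scale k (val p _)) (val q _)).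
  by rewrite pu qw /coprodV_scale coprodV_addE.
rewrite -[LHS]/(coprodV_add (coprodV_scale k (val p _)) (val q _)).
by rewrite pb// qb// /coprodV_scale coprodV_addE linearP.
Qed.

Lemma cone_space_uniform : exists L, forall a F, cone_space a F ->
  exists2 p, F = \pi_E p & forall y, (L <= wlen A' y)%N -> mult_at (val p) y.
Proof.
have [L hL] := psi_proper deep; exists L => a F [p [-> p0 pm]].
exists p => // y Ly; have [ay|ay] := boolP (cone A (val a) (psi y)).
  by rewrite -(psiK y); apply: pm; [|exact: hL].
move=> c yc; exists 0; rewrite (p0 y c)//; split=> // c' yc'.
rewrite linear0 (p0 _ c')//; last exact: ends_with_extend.
by rewrite psiM deep_cone// hL.
Qed.

(** With the uniform threshold L, the values on one A'-sphere beyond L determine an element, which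
    leaves finitely many coordinates. *)
Lemma cone_space_param a :
  exists n (f : {linear 'rV[R[i]]_n -> E}), injective f /\ range f = cone_space a.
Proof.
have [L hL] := cone_space_uniform.
(* Radius [L.+1] ensures that the parent of a point outside the sphere is nonempty and ends with a
   letter. *)
have [n nE] : exists n, n = L.+1 by exists L.+1.
pose T : finType :=
  ('I_(size (rwords A' n)) * {c : A' & 'I_(\dim {:S c})})%type.
pose value p (t : T) : R[i] := coord (vbasis {:S (tag t.2)}) (tagged t.2)
  (component (tag t.2) (val p (wprod (nth [::] (rwords A' n) t.1)))).
(* Only coordinates whose letter ends the sphere point are prescribed: the value of p there lies in
   the space of that letter. *)
pose coords (F : E) (v : 'rV[R[i]]_#|T|) := exists p, [/\ F = \pi_E p,
  forall y, (L <= wlen A' y)%N -> mult_at (val p) y &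
  forall t : T, ends_with (tag t.2) (wprod (nth [::] (rwords A' n) t.1)) ->
    v 0 (enum_rank t) = value p t].
apply: (@finite_dim_param R[i] (E : lmodType R[i]) (cone_space a) #|T| coords).
- exact: cone_space0.
- exact: cone_space_linear.
- move=> k F1 F2 v w [p [-> pm pv]] [q [-> qm qw]].
  exists (mult_fun_add (mult_fun_scale k p) q); split.
  + by rewrite [k *: _](Defs.pi_scale hG hA' k p) [LHS](Defs.pi_add hG hA').
  + move=> y Ly c yc; have [u [pu pb]] := pm y Ly c yc.
    have [u' [qu qb]] := qm y Ly c yc; exists (k *: u + u'); split=> [|c' yc'].
      rewrite -[LHS]/(coprodV_add (coprodV_scale k (val p _)) (val q _)).
      by rewrite pu qu /coprodV_scale coprodV_addE.
    rewrite -[LHS]/(coprodV_add (coprodV_scale k (val p _)) (val q _)).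
    by rewrite pb// qb// /coprodV_scale coprodV_addE linearP.
  + move=> t tc; rewrite !mxE (pv t tc) (qw t tc) /value.
    have Lt : (L <= wlen A' (wprod (nth [::] (rwords A' n) t.1)))%N.
      by rewrite (wlen_wprod hA' (mem_nth _ (ltn_ord _))) nE.
    have [u [pu _]] := pm _ Lt _ tc; have [u' [qu _]] := qm _ Lt _ tc.
    rewrite -[val (mult_fun_add _ _) _]/(coprodV_add
      (coprodV_scale k (val p _)) (val q _)).
    by rewrite pu qu /coprodV_scale coprodV_addE !component_inV linearP.
- move=> F /hL[p -> pm]; exists (\row_i value p (enum_val i)), p; split=> // t _.
  by rewrite mxE enum_rankK.
move=> F _ [p [-> pm p0]].
have {}p0 y c : wlen A' y = n -> ends_with c y -> val p y = inV (0 : S c).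
  move=> yL yc; have [|v [pv _]] := pm y _ c yc; first by rewrite yL nE.
  rewrite pv; congr inV; rewrite (coord_vbasis (memvf v)) big1// => j _.
  have yi : (index (redword A' y) (rwords A' n) < size (rwords A' n))%N.
    by rewrite index_mem mem_redword_rwords.
  pose t : T := (Ordinal yi, Tagged (fun c : A' => 'I_(\dim {:S c})) j).
  have tE : wprod (nth [::] (rwords A' n) t.1) = y.
    by rewrite [nth _ _ _]nth_index ?mem_redword_rwords// redwordK.
  have := p0 t; rewrite /value tE pv component_inV => /(_ yc) <-.
  by rewrite mxE scale0r.
rewrite -[RHS]/(\pi_E zero).
apply: Hinf_eqI; exists n => y c /subnKC; move: (_ - _)%N => k.
elim: k y c => [|k IH] y c yk yc.
  by rewrite (p0 y c)// ?(zeroE yc)// -yk addn0.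
have [|z [c' [zc yE yz]]] := ends_with_split hA' yc; first by rewrite -yk nE addnS.
have zk : (n + k)%N = wlen A' z by apply: succn_inj; rewrite -yz -yk addnS.
rewrite yE in yz yc *.
have Lz : (L <= wlen A' z)%N by rewrite -zk nE addSn leqW// leq_addr.
have [v [pv pb]] := pm z Lz c' zc.
rewrite pb// (zeroE yc).
have := IH z c' zk zc; rewrite pv (zeroE zc) => /(congr1 (component c')).
by rewrite !component_inV => ->; rewrite linear0.
Qed.

End Cutting.

(** * Change of generators and composition with automorphisms *)

(** The Hilbert space K, the subspace M and the operator U are kept; composing the dense embedding
    with the isomorphism T makes K a completion of the new space over A. *)
Lemma Mult_precompose (R : realType) (G : groupType) (hG : nonabelian G)
    (A A' : {fset G}) (hA : symmetric_free A) (hA' : symmetric_free A')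
    (phi : {multiplicative G -> G}) (H : hilbert R) (pi : G -> H -> H) :
  bijective phi -> Mult hG hA' pi -> Mult hG hA (fun x => pi (phi x)).
Proof.
move=> [psi phiK psiK] [[piU pi1 piM] [S' [K [piK [[KU K1 KM] KE]]]]].
move=> [M [U [subM denseM unitU UM UE]]].
have phi1 : phi 1%g = 1%g.
  by apply: (mulgI (phi 1%g)); rewrite -gmulfM !mulg1.
(* Translations are isometric because K is unitary and contains an isometric copy of H^oo. *)
have iso_ptranslate x (F1 F2 : Hinf S' hG hA') :
    Hinf_dot hG hA' S' (ptranslate phi x F1) (ptranslate phi x F2) =
    Hinf_dot hG hA' S' F1 F2.
  rewrite -!(cpl_isometry K) /ptranslate -!KE.
  by case: (KU (phi x)) => _ _ ->.
have [S [T [Tiso Tsurj Ttranslate]]] : exists (S : ip_system R A)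
    (T : {linear Hinf S hG hA -> Hinf S' hG hA'}),
    [/\ forall f1 f2,
          Hinf_dot hG hA' S' (T f1) (T f2) = Hinf_dot hG hA S f1 f2,
        range T = setT &
        forall g (f : Hinf S hG hA),
          T (Hinf_translate g f) = ptranslate phi g (T f)].
  apply: (@cone_system_iso R G A hG hA (Hinf S' hG hA') (Hinf_dot hG hA' S')
    (fun g => ptranslate phi g) (fun x => cutoff hA phiK psiK x)
    (@cone_space R G A A' hG hA hA' phi psi phiK S')).
  - exact: ptranslate1.
  - exact: ptranslateM.
  - exact: iso_ptranslate.
  - exact: cutoff_ptranslate.
  - exact: cutoff_nest.
  - exact: cutoff_idem.
  - exact: cutoff_orth.
  - exact: cutoff_sep.
  - exact: cutoff_adj.
  - exact: cone_space_param.
  - exact: cutoff_cone_space.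
  - exact: cone_space_step.
  - exact: cone_space_ev.
have rangeE : range (cpl_map K \o T) = range (cpl_map K).
  apply/seteqP; split=> _ [F _ <-]; first by exists (T F).
  by have [f _ <-] : range T F by [rewrite Tsurj]; exists f.
have iso F1 F2 : hdot _ ((cpl_map K \o T) F1) ((cpl_map K \o T) F2) =
    Hinf_dot hG hA S F1 F2.
  by rewrite cpl_isometry Tiso.
have dns : dense (range (cpl_map K \o T)) by rewrite rangeE; exact: cpl_dense.
split.
  by split=> [x|v|x y v]; rewrite ?phi1 ?gmulfM.
exists S, (Completion iso dns), (fun x => piK (phi x)); split.
- by split=> [x|v|x y v]; rewrite ?phi1 ?gmulfM //; exact: KU.
- by move=> x F; rewrite /= Ttranslate KE.
- exists M, U; split=> //; first by rewrite UM -rangeE.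
  by move=> m x Mm; exact: UE.
Qed.

Theorem theorem2 (R : realType) (G : groupType)
    (hfree : exists S : {fset G}, free_basis S) (hG : nonabelian G) :
  (forall (A A' : {fset G}) (hA : symmetric_free A) (hA' : symmetric_free A')
      (H : hilbert R) (pi : G -> H -> H),
    Mult hG hA' pi -> Mult hG hA pi) /\
  (forall (H : hilbert R) (pi : G -> H -> H) (phi : {multiplicative G -> G}),
    bijective phi -> MultGroup hG pi ->
    MultGroup hG (fun x => pi (phi x))).
Proof.
split=> [A A' hA hA' H pi|H pi phi phi_bij [A [hA piA]]].
  (* The change of generators is the case of the identity automorphism; invariance is the case A' =
     A. *)
  by apply: (Mult_precompose hA (phi := idfun)); exists idfun.
by exists A, hA; exact: Mult_precompose piA.
Qed.
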